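(* Let $m,n\ge1$ with $m\neq n$. Then $H^m\left(\tfrac1{\sqrt2}\right)\times H^n\left(\tfrac1{\sqrt2}\right)$, immersed in the anti de Sitter space $H^{m+n+1}_1(1)$ by $(u,v)\mapsto x=(u,v)$, is a proper biharmonic space-like hypersurface of $H^{m+n+1}_1(1)$.
   Context: For $k\ge1$ and $r>0$, let $R^{k+1}_1$ be $\mathbb{R}^{k+1}$ with the scalar product $\langle y,y\rangle=y_1^2+\cdots+y_k^2-y_{k+1}^2$, and let $H^k(r)$ be the connected component through $(0,\ldots,0,r)$ of $\{y\in R^{k+1}_1:\langle y,y\rangle=-r^2\}$ with the induced (Riemannian) metric. Identify $R^{m+n+2}_2$ with the orthogonal direct sum $R^{m+1}_1\oplus R^{n+1}_1$, so that $\langle (u,v),(u,v)\rangle=\langle u,u\rangle+\langle v,v\rangle$. The anti de Sitter (ADS) space is $H^{m+n+1}_1(1)=\{x\in R^{m+n+2}_2:\langle x,x\rangle=-1\}$ with the induced metric (index $1$, constant sectional curvature $-1$). The product $H^m(r)\times H^n(s)$ carries the product metric. A hypersurface $\phi:M\to N$ of a pseudo-Riemannian manifold $N$ of index $1$ is space-like if its induced metric is positive definite. The tension field is $\tau(\phi)=\mathrm{trace}\,\nabla d\phi$. The second tension field is $\tau_2(\phi)=-\Delta^\phi\tau(\phi)-\mathrm{trace}\,R^N(d\phi,\tau(\phi))d\phi$, where $R^N(X,Y)Z=\nabla_X\nabla_YZ-\nabla_Y\nabla_XZ-\nabla_{[X,Y]}Z$ and $\Delta^\phi=-\mathrm{trace}(\nabla^\phi\nabla^\phi-\nabla^\phi_{\nabla})$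 is the (rough) Laplacian on sections of $\phi^{-1}TN$. The hypersurface is biharmonic if its isometric immersion $\phi$ satisfies $\tau_2(\phi)=0$, and proper biharmonic if moreover $\phi$ is not harmonic, i.e. $\tau(\phi)\not\equiv0$. *)

(* Defs.v *)
From HB Require Import structures.
From mathcomp Require Import all_boot all_order all_algebra.
From mathcomp Require Import all_classical all_reals all_analysis.

Set Implicit Arguments.
Unset Strict Implicit.
Unset Printing Implicit Defensive.

Import Order.TTheory GRing.Theory Num.Theory.
Import numFieldNormedType.Exports.

Local Open Scope classical_set_scope.
Local Open Scope ring_scope.

(* C^oo on an open set: every iterated directional derivative of f is
   Frechet differentiable (hence continuous) at every point of U. *)
Definition smooth_on (R : realType) (V W : normedModType R)
    (U : set V) (f : V -> W) : Prop :=
  forall (vs : seq V) (x : V), U x ->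
    differentiable (foldr (fun v g => fun y => 'D_v g y) f vs) x.

Definition partial (R : realType) (d : nat) (W : normedModType R)
    (i : 'I_d) (f : 'rV[R]_d -> W) : 'rV[R]_d -> W :=
  fun x => 'D_(delta_mx 0 i) f x.

(* In local coordinates a metric is its Gram
   matrix g = (g_ij) as a function of the coordinates; a vector field along a
   map F between coordinate domains is the row vector of its components in
   the coordinate frame of the target. *)

(* The row vector (Gamma^k_ij)_k of the Levi-Civita connection of g. *)
Definition christoffel (R : realType) (d : nat) (g : 'rV[R]_d -> 'M[R]_d)
    (i j : 'I_d) (x : 'rV[R]_d) : 'rV[R]_d :=
  \row_k (2^-1 * \sum_l invmx (g x) k l *
    (partial i (fun y => g y j l) x + partial j (fun y => g y i l) x
     - partial l (fun y => g y i j) x)).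

(* nabla^F_{d_i} V, for V a section of F^{-1}TN and h the metric of N. *)
Definition covd (R : realType) (p q : nat) (h : 'rV[R]_q -> 'M[R]_q)
    (F : 'rV[R]_p -> 'rV[R]_q) (i : 'I_p) (V : 'rV[R]_p -> 'rV[R]_q)
    (x : 'rV[R]_p) : 'rV[R]_q :=
  partial i V x +
  \sum_(a < q) \sum_(b < q)
    (partial i F x 0 a * V x 0 b) *: christoffel h a b (F x).

(* R(d_a, d_b) d_c = nabla_a nabla_b d_c - nabla_b nabla_a d_c, the bracket of
   coordinate fields being zero, extended to a tensor by trilinearity. *)
Definition curvature (R : realType) (q : nat) (h : 'rV[R]_q -> 'M[R]_q)
    (y A B C : 'rV[R]_q) : 'rV[R]_q :=
  \sum_(a < q) \sum_(b < q) \sum_(c < q)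
    (A 0 a * B 0 b * C 0 c) *:
      (covd h id a (covd h id b (fun=> delta_mx 0 c)) y
       - covd h id b (covd h id a (fun=> delta_mx 0 c)) y).

Definition trace_metric (R : realType) (p q : nat) (g : 'rV[R]_p -> 'M[R]_p)
    (B : 'I_p -> 'I_p -> 'rV[R]_p -> 'rV[R]_q) (x : 'rV[R]_p) : 'rV[R]_q :=
  \sum_(i < p) \sum_(j < p) invmx (g x) i j *: B i j x.

(* (nabla dF)(d_i, d_j) *)
Definition second_form (R : realType) (p q : nat)
    (g : 'rV[R]_p -> 'M[R]_p) (h : 'rV[R]_q -> 'M[R]_q)
    (F : 'rV[R]_p -> 'rV[R]_q) (i j : 'I_p) (x : 'rV[R]_p) : 'rV[R]_q :=
  covd h F i (partial j F) x
  - \sum_(k < p) christoffel g i j x 0 k *: partial k F x.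

Definition tension (R : realType) (p q : nat)
    (g : 'rV[R]_p -> 'M[R]_p) (h : 'rV[R]_q -> 'M[R]_q)
    (F : 'rV[R]_p -> 'rV[R]_q) : 'rV[R]_p -> 'rV[R]_q :=
  trace_metric g (second_form g h F).

Definition rough_laplacian (R : realType) (p q : nat)
    (g : 'rV[R]_p -> 'M[R]_p) (h : 'rV[R]_q -> 'M[R]_q)
    (F V : 'rV[R]_p -> 'rV[R]_q) (x : 'rV[R]_p) : 'rV[R]_q :=
  - trace_metric g (fun i j y =>
      covd h F i (covd h F j V) y
      - \sum_(k < p) christoffel g i j y 0 k *: covd h F k V y) x.

Definition bitension (R : realType) (p q : nat)
    (g : 'rV[R]_p -> 'M[R]_p) (h : 'rV[R]_q -> 'M[R]_q)
    (F : 'rV[R]_p -> 'rV[R]_q) (x : 'rV[R]_p) : 'rV[R]_q :=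
  - rough_laplacian g h F (tension g h F) x
  - trace_metric g (fun i j y =>
      curvature h (F y) (partial i F y) (tension g h F y) (partial j F y)) x.

Definition posdef (R : realType) (d : nat) (G : 'M[R]_d) : Prop :=
  forall v : 'rV[R]_d, v != 0 -> 0 < (v *m G *m v^T) 0 0.

Definition negdef_on (R : realType) (d : nat) (G W : 'M[R]_d) : Prop :=
  forall v : 'rV[R]_d, v != 0 -> (v <= W)%MS -> (v *m G *m v^T) 0 0 < 0.

(* The index is the largest dimension of a negative definite subspace. *)
Definition has_index (R : realType) (d : nat) (G : 'M[R]_d) (nu : nat) : Prop :=
  (exists W : 'M[R]_d, \rank W = nu /\ negdef_on G W) /\
  (forall W : 'M[R]_d, negdef_on G W -> (\rank W <= nu)%N).

(* A subset of a normed space with a scalar product (of any signature), to be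
   regarded as a submanifold of dimension [sdim] with the induced metric. *)
Record subspace_data (R : realType) := SubspaceData {
  ambient : normedModType R;
  scalar : ambient -> ambient -> R;
  carrier : set ambient;
  sdim : nat
}.
Arguments SubspaceData {R}.
Arguments ambient {R} s.
Arguments scalar {R} s.
Arguments carrier {R} s.
Arguments sdim {R} s.

(* X : U -> M is a local parametrization (inverse of a chart): a smooth
   injective immersion which is a homeomorphism onto an open subset of M. *)
Definition local_param (R : realType) (M : subspace_data R)
    (U : set 'rV[R]_(sdim M)) (X : 'rV[R]_(sdim M) -> ambient M) : Prop :=
  [/\ open U, smooth_on U X,
      forall x, U x -> injective ('d X x),
      {in U &, injective X} &
      forall W, open W -> W `<=` U ->
        exists2 O, open O & X @` W = carrier M `&` O].

Definition submanifold (R : realType) (M : subspace_data R) : Prop :=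
  forall p, carrier M p -> exists U X, local_param (M := M) U X /\ (X @` U) p.

Definition induced_metric (R : realType) (M : subspace_data R)
    (X : 'rV[R]_(sdim M) -> ambient M) (x : 'rV[R]_(sdim M)) :
    'M[R]_(sdim M) :=
  \matrix_(i, j) scalar M (partial i X x) (partial j X x).

Definition pseudo_riemannian (R : realType) (N : subspace_data R) (nu : nat) :
    Prop :=
  submanifold N /\
  forall U X, local_param (M := N) U X -> forall x, U x ->
    induced_metric X x \in unitmx /\ has_index (induced_metric X x) nu.

(* F = Y^{-1} o phi o X is a smooth coordinate expression of phi. *)
Definition local_expr (R : realType) (M N : subspace_data R)
    (phi : ambient M -> ambient N)
    (U : set 'rV[R]_(sdim M)) (X : 'rV[R]_(sdim M) -> ambient M)
    (W : set 'rV[R]_(sdim N)) (Y : 'rV[R]_(sdim N) -> ambient N)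
    (F : 'rV[R]_(sdim M) -> 'rV[R]_(sdim N)) : Prop :=
  [/\ local_param U X, local_param W Y, smooth_on U F &
      forall x, U x -> W (F x) /\ Y (F x) = phi (X x)].

Definition smooth_map (R : realType) (M N : subspace_data R)
    (phi : ambient M -> ambient N) : Prop :=
  forall p, carrier M p ->
    exists U X W Y F, local_expr phi U X W Y F /\ (X @` U) p.

(* The notions below are invariant under changes of charts, so requiring them
   in all local expressions of phi is the same as requiring them in some local
   expression around every point of M. *)

Definition pullback_metric (R : realType) (p q : nat)
    (h : 'rV[R]_q -> 'M[R]_q) (F : 'rV[R]_p -> 'rV[R]_q) (x : 'rV[R]_p) :
    'M[R]_p :=
  'J F x *m h (F x) *m ('J F x)^T.

Definition immersion (R : realType) (M N : subspace_data R)
    (phi : ambient M -> ambient N) : Prop :=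
  smooth_map phi /\
  forall U X W Y F, local_expr phi U X W Y F -> forall x, U x ->
    \rank ('J F x) = sdim M.

Definition isometric (R : realType) (M N : subspace_data R)
    (phi : ambient M -> ambient N) : Prop :=
  forall U X W Y F, local_expr phi U X W Y F -> forall x, U x ->
    pullback_metric (induced_metric Y) F x = induced_metric X x.

Definition spacelike_hypersurface (R : realType) (M N : subspace_data R)
    (phi : ambient M -> ambient N) : Prop :=
  [/\ submanifold M, pseudo_riemannian N 1, sdim N = (sdim M).+1,
      immersion phi &
      forall U X W Y F, local_expr phi U X W Y F -> forall x, U x ->
        posdef (pullback_metric (induced_metric Y) F x)].

Definition harmonic_map (R : realType) (M N : subspace_data R)
    (phi : ambient M -> ambient N) : Prop :=
  forall U X W Y F, local_expr phi U X W Y F -> forall x, U x ->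
    tension (induced_metric X) (induced_metric Y) F x = 0.

Definition biharmonic_map (R : realType) (M N : subspace_data R)
    (phi : ambient M -> ambient N) : Prop :=
  forall U X W Y F, local_expr phi U X W Y F -> forall x, U x ->
    bitension (induced_metric X) (induced_metric Y) F x = 0.

Definition proper_biharmonic (R : realType) (M N : subspace_data R)
    (phi : ambient M -> ambient N) : Prop :=
  [/\ isometric phi, biharmonic_map phi & ~ harmonic_map phi].

Arguments spacelike_hypersurface {R} M N phi.
Arguments proper_biharmonic {R} M N phi.

(* The scalar product of R^{k+1}_1; the last coordinate is the timelike one. *)
Definition lorentz (R : realType) (k : nat) (y z : 'rV[R]_k.+1) : R :=
  \sum_(i < k) y 0 (widen_ord (leqnSn k) i) * z 0 (widen_ord (leqnSn k) i)
  - y 0 ord_max * z 0 ord_max.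

Definition hyperbolic (R : realType) (k : nat) (r : R) : set 'rV[R]_k.+1 :=
  connected_component [set y : 'rV[R]_k.+1 | lorentz y y = - r ^+ 2]
    (r *: delta_mx 0 ord_max).
Arguments hyperbolic {R} k r.

(* The orthogonal direct sum R^{m+1}_1 (+) R^{n+1}_1 = R^{m+n+2}_2. *)
Definition sum_scalar (R : realType) (m n : nat)
    (x y : 'rV[R]_m.+1 * 'rV[R]_n.+1) : R :=
  lorentz x.1 y.1 + lorentz x.2 y.2.

(* H^m(r) x H^n(s); the product metric is the one induced by the direct sum
   of the two ambient scalar products. *)
Definition hyperbolic_prod (R : realType) (m n : nat) (r s : R) :
    subspace_data R :=
  @SubspaceData R ('rV[R]_m.+1 * 'rV[R]_n.+1)%type (@sum_scalar R m n)
    (hyperbolic m r `*` hyperbolic n s) (m + n).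

Definition anti_de_sitter (R : realType) (m n : nat) : subspace_data R :=
  @SubspaceData R ('rV[R]_m.+1 * 'rV[R]_n.+1)%type (@sum_scalar R m n)
    [set x | sum_scalar x x = -1] (m + n + 1).

Definition inclusion_map (R : realType) (m n : nat) (r s : R) :
    ambient (hyperbolic_prod m n r s) -> ambient (anti_de_sitter R m n) :=
  fun p => (p.1, p.2).
Arguments inclusion_map {R} m n r s.

(* Main.v *)
From HB Require Import structures.
Require Import Defs.
From mathcomp Require Import all_boot all_order all_algebra.
From mathcomp Require Import all_classical all_reals all_analysis.
From mathcomp Require Import ring lra.

Set Implicit Arguments.
Unset Strict Implicit.
Unset Printing Implicit Defensive.

Import Order.TTheory GRing.Theory Num.Theory.
Import numFieldNormedType.Exports.

Local Open Scope classical_set_scope.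
Local Open Scope ring_scope.

(** Let E be the ambient space, x = (u, v) the position vector and r^2 = 1/2, so that u and v
    have square -1/2 and x has square -1. In arbitrary charts X of the product and Y of the
    anti de Sitter space, with Y o F = X, the differential of Y reads a vector field along F as
    a field of vectors of E, and this reading is injective. Everything is computed in E.

    The vector Y is a unit normal of the anti de Sitter space, and the Koszul formula
    ([christoffel_gram]) gives the Gauss formula Y_ab = Gamma^k_ab Y_k + h_ab Y
    ([gauss_formula]). Hence a covariant derivative along F reads as an ordinary derivative
    minus its component along x ([differential_covd]), and the curvature tensor is that of
    constant curvature -1 ([differential_curvature]). The Koszul formula uses the symmetry of
    second derivatives, proved from the mean value theorem ([derive_swap]).

    On the product, the Hessian of the position vector is orthogonal to the coordinate fields,
    hence combines (u, 0) and (0, v), with coefficients 2 <u_i, u_j> and 2 <v_i, v_j>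
    ([hyperbolic_hessian]). Their traces are m and n, because the sum over a tangent frame and
    the normal of one factor computes the trace of the projection onto that factor
    ([hyperbolic_trace1]). So the Laplacian of x is (2 m u, 2 n v); the tension field is
    (m - n) eta with eta = (u, -v), not zero when m differs from n ([inclusion_tension]). In the
    bitension field, the rough Laplacian term is (m + n) (m - n) eta and the curvature term is
    its opposite ([inclusion_bitension]).

    The product is space-like because a vector orthogonal to a timelike vector of a Lorentz
    space is spacelike ([lorentz_orthogonal_gt0]). The anti de Sitter space has index 1: adding
    the timelike vector x to a negative tangent space gives a negative space of E, which has
    index 2 ([ads_negative_rank]). Both spaces are covered by graphs of square roots
    ([product_chart_local_param], [square_root_chart]), the component of the hyperboloid being
    its upper sheet ([hyperbolicE]). *)

(** * Smoothness by induction on the order *)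

Section Calculus.
Context {R : realType} {V W : normedModType R}.
Implicit Types (f g : V -> W) (U : set V).

(** The difference of two functions that agree near x is o(h), so its differential at x is 0. *)
Lemma differentiable_near_eq f g x :
  (\near x, f x = g x) -> differentiable f x -> differentiable g x.
Proof.
move=> fg df.
have gE : g = f + (g - f) by apply/funext => y /=; rewrite !fctE addrC subrK.
rewrite gE; apply: differentiableD => //.
have z : (g - f) \o shift x = cst ((g - f) x) + (GRing.null_fun W : {linear V -> W}) +o_ 0 id.
  apply/eqaddoP => e e0.
  have : \forall y \near 0, f (y + x) = g (y + x).
    by have := fg; rewrite (near_shift 0 x) /= subr0.
  apply: filterS => y fgy.
  rewrite !fctE /= /shift /= fgy subrr (nbhs_singleton fg) subrr.
  by rewrite !addr0 subr0 normr0 mulr_ge0// ltW.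
have c0 : continuous (GRing.null_fun W : {linear V -> W}) by exact: cst_continuous.
by apply/diff_locallyP; rewrite (diff_unique c0 z); split.
Qed.

End Calculus.

Section IteratedDerivatives.
Context {R : realType} {V : normedModType R}.

(** The order-by-order form of smoothness: unlike iterated derivatives, it can be
    propagated through products and square roots by induction on the order. *)
Fixpoint smooth_upto (W : normedModType R) (n : nat) (U : set V)
    (f : V -> W) : Prop :=
  (forall x, U x -> differentiable f x) /\
  (if n is n'.+1 then forall v, smooth_upto n' U (fun y => 'D_v f y) else True).

Lemma smooth_on_derive (W : normedModType R) (U : set V) (f : V -> W) v :
  smooth_on U f -> smooth_on U (fun y => 'D_v f y).
Proof.
(* The first derivative taken is along the last direction of the list. *)
by move=> fU vs x Ux; have := fU (rcons vs v) x Ux; rewrite foldr_rcons.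
Qed.

Lemma smooth_on_differentiable (W : normedModType R) (U : set V) (f : V -> W) x :
  smooth_on U f -> U x -> differentiable f x.
Proof. by move=> fU Ux; exact: (fU [::] x Ux). Qed.

Lemma smooth_onP (W : normedModType R) (U : set V) (f : V -> W) :
  smooth_on U f <-> forall n, smooth_upto n U f.
Proof.
split=> [fU n|].
  elim: n f fU => [|n IHn] f fU; (split; first by move=> x; exact: smooth_on_differentiable).
    by [].
  by move=> v; apply: IHn; exact: smooth_on_derive.
move=> fn vs; elim/last_ind: vs f fn => [|vs v IHvs] f fn x Ux /=.
  by have [+ _] := fn 0%N; apply.
rewrite foldr_rcons; apply: IHvs => // n.
by have [_ +] := fn n.+1; apply.
Qed.

Section Open.
Variables (U : set V) (oU : open U).

Lemma open_near (P : V -> Prop) x : (forall y, U y -> P y) -> U x -> \near x, P x.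
Proof. by move=> PU Ux; apply: filterS PU _; exact: open_nbhs_nbhs. Qed.

Lemma derive_eq_on (W : normedModType R) (f g : V -> W) x v :
  (forall y, U y -> f y = g y) -> U x -> 'D_v f x = 'D_v g x.
Proof. by move=> fg Ux; apply: near_eq_derive; exact: open_near fg Ux. Qed.

Lemma differentiable_eq_on (W : normedModType R) (f g : V -> W) x :
  (forall y, U y -> f y = g y) -> U x -> differentiable f x -> differentiable g x.
Proof. by move=> fg Ux; apply: differentiable_near_eq; exact: open_near fg Ux. Qed.

Lemma smooth_upto_eq (W : normedModType R) n (f g : V -> W) :
  (forall y, U y -> f y = g y) -> smooth_upto n U f -> smooth_upto n U g.
Proof.
elim: n f g => [|n IHn] f g fg [df dn]; split=> //;
  try by move=> x Ux; exact: differentiable_eq_on fg Ux (df x Ux).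
by move=> v; apply: IHn (dn v) => y Uy; exact: derive_eq_on.
Qed.

Lemma smooth_uptoW (W : normedModType R) n (f : V -> W) :
  smooth_upto n.+1 U f -> smooth_upto n U f.
Proof.
elim: n f => [|n IHn] f [df dn]; split=> // v.
by apply: IHn; exact: dn.
Qed.

Lemma smooth_upto_cst (W : normedModType R) n (c : W) : smooth_upto n U (fun=> c).
Proof.
elim: n c => [|n IHn] c; split=> //; try by move=> x _; exact: differentiable_cst.
by move=> v; apply: smooth_upto_eq (IHn 0) => y Uy; rewrite derive_cst.
Qed.

Lemma smooth_uptoD (W : normedModType R) n (f g : V -> W) :
  smooth_upto n U f -> smooth_upto n U g -> smooth_upto n U (f \+ g).
Proof.
elim: n f g => [|n IHn] f g [df fn] [dg gn]; split=> //;
  try by move=> x Ux; apply: differentiableD; [exact: df|exact: dg].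
move=> v; apply: smooth_upto_eq (IHn _ _ (fn v) (gn v)) => y Uy.
by rewrite deriveD//; apply: diff_derivable; [exact: df|exact: dg].
Qed.

Lemma smooth_uptoM n (f g : V -> R) :
  smooth_upto n U f -> smooth_upto n U g -> smooth_upto n U (fun y => f y * g y).
Proof.
elim: n f g => [|n IHn] f g Hf Hg.
  by case: Hf Hg => [df _] [dg _]; split=> // x Ux; exact: (@differentiableM _ _ f g x (df x Ux) (dg x Ux)).
have [df fn] := Hf; have [dg gn] := Hg.
split=> [x Ux|v]; first by exact: (@differentiableM _ _ f g x (df x Ux) (dg x Ux)).
have K : smooth_upto n U (fun y => f y * 'D_v g y + g y * 'D_v f y).
  by apply: smooth_uptoD; apply: IHn; solve [exact: smooth_uptoW|exact: fn|exact: gn].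
apply: smooth_upto_eq K => y Uy.
by rewrite [RHS](@deriveM _ _ f g)//; apply: diff_derivable; [exact: df|exact: dg].
Qed.

Lemma smooth_uptoV n (f : V -> R) : (forall x, U x -> f x != 0) ->
  smooth_upto n U f -> smooth_upto n U (fun y => (f y)^-1).
Proof.
move=> f0; elim: n => [|n IHn] Hf; have [df fn] := Hf.
  by split=> // x Ux; exact: (@differentiableV _ _ f x (df x Ux) (f0 x Ux)).
split=> [x Ux|v]; first by exact: (@differentiableV _ _ f x (df x Ux) (f0 x Ux)).
have iV := IHn (smooth_uptoW Hf).
have K : smooth_upto n U (fun y => (-1) * ((f y)^-1 * (f y)^-1) * 'D_v f y).
  apply: smooth_uptoM; last exact: fn.
  by apply: smooth_uptoM; [exact: smooth_upto_cst|exact: smooth_uptoM].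
apply: smooth_upto_eq K => y Uy.
rewrite (@deriveV _ _ f)//; [|exact: f0|exact: diff_derivable (df y Uy)].
by rewrite /GRing.scale /= expr2 invfM mulN1r.
Qed.

Lemma derive_linear_comp (W W' : normedModType R) (L : {linear W -> W'})
    (f : V -> W) x v :
  continuous L -> differentiable f x ->
  differentiable (fun y => L (f y)) x /\
  'D_v (fun y => L (f y)) x = L ('D_v f x).
Proof.
move=> cL df; have dL : differentiable L (f x) by exact: linear_differentiable.
split; first exact: (differentiable_comp df dL).
rewrite deriveE; last exact: (differentiable_comp df dL).
by rewrite (diff_comp df dL) /= deriveE// diff_lin.
Qed.

Lemma smooth_upto_linear (W W' : normedModType R) n (L : {linear W -> W'})
    (f : V -> W) :
  continuous L -> smooth_upto n U f -> smooth_upto n U (fun y => L (f y)).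
Proof.
move=> cL; elim: n f => [|n IHn] f [df fn].
  by split=> // x Ux; have [] := derive_linear_comp 0 cL (df x Ux).
split=> [x Ux|v]; first by have [] := derive_linear_comp 0 cL (df x Ux).
apply: smooth_upto_eq (IHn _ (fn v)) => y Uy.
by have [_ ->] := derive_linear_comp v cL (df y Uy).
Qed.

Lemma smooth_upto_id n : smooth_upto n U (fun y : V => y).
Proof.
case: n => [|n]; split=> // v.
by apply: smooth_upto_eq (smooth_upto_cst n v) => y Uy; rewrite derive_id.
Qed.

Lemma differentiable_sqrt (f : V -> R) x v : differentiable f x -> 0 < f x ->
  differentiable (fun y => Num.sqrt (f y)) x /\
  'D_v (fun y => Num.sqrt (f y)) x = (2 * Num.sqrt (f x))^-1 * 'D_v f x.
Proof.
move=> df fx; have sd := is_derive1_sqrt fx.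
have ds : differentiable (@Num.sqrt R) (f x) by apply/derivable1_diffP; exact: ex_derive.
have dc : differentiable (fun y => Num.sqrt (f y)) x by exact: (differentiable_comp df ds).
split=> //; rewrite deriveE// (diff_comp df ds) /= deriveE//.
have -> : 'd Num.sqrt (f x) ('d f x v) = ('d f x v) * 'd Num.sqrt (f x) 1.
  by rewrite -[in LHS](mulr1 ('d f x v)) [LHS]linearZ.
rewrite mulrC; congr (_ * _).
by rewrite -deriveE//; exact: (@derive_val _ _ _ _ _ _ _ sd).
Qed.

(** A derivative of the square root of a positive function is a product of smooth functions and
    of the inverse of that same root, known to be smooth to one order less. *)
Lemma smooth_upto_sqrt n (f : V -> R) : (forall x, U x -> 0 < f x) ->
  smooth_upto n U f -> smooth_upto n U (fun y => Num.sqrt (f y)).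
Proof.
move=> f0; elim: n => [|n IHn] Hf; have [df fn] := Hf.
  by split=> // x Ux; have [] := differentiable_sqrt 0 (df x Ux) (f0 x Ux).
split=> [x Ux|v]; first by have [] := differentiable_sqrt 0 (df x Ux) (f0 x Ux).
have iS := IHn (smooth_uptoW Hf).
have K : smooth_upto n U (fun y => (2 * Num.sqrt (f y))^-1 * 'D_v f y).
  apply: smooth_uptoM; last exact: fn.
  apply: smooth_uptoV.
    by move=> x Ux; rewrite mulf_neq0// sqrtr_eq0 -ltNge f0.
  by apply: smooth_uptoM => //; exact: smooth_upto_cst.
apply: smooth_upto_eq K => y Uy.
by have [_ ->] := differentiable_sqrt v (df y Uy) (f0 y Uy).
Qed.

End Open.
End IteratedDerivatives.

(** * Directional derivatives and their symmetry *)

Section DirectionalDerivatives.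
Context {R : realType}.

Lemma continuous_linear_rV (W : normedModType R) n (L : {linear 'rV[R]_n -> W}) :
  continuous L.
Proof.
have -> : (L : _ -> _) = fun x => \sum_(i < n) x 0 i *: L (delta_mx 0 i).
  apply/funext => x; rewrite {1}(row_sum_delta x) linear_sum.
  by apply: eq_bigr => i _; rewrite linearZ.
move=> x; apply: differentiable_continuous.
have -> : (fun x0 : 'rV[R]_n => \sum_(i < n) x0 0 i *: L (delta_mx 0 i)) =
   \sum_(i < n) (fun x0 : 'rV[R]_n => x0 0 i *: L (delta_mx 0 i)).
  by apply/funext => z; rewrite fct_sumE.
apply: differentiable_sum => i; apply: differentiableZl.
exact: differentiable_coord.
Qed.

Lemma diff_rV (W : normedModType R) n (f : 'rV[R]_n -> W) x v :
  differentiable f x -> 'd f x v = \sum_(i < n) v 0 i *: partial i f x.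
Proof.
move=> df; rewrite {1}(row_sum_delta v) linear_sum.
by apply: eq_bigr => i _; rewrite linearZ /= /partial deriveE.
Qed.

Lemma partial_comp (W : normedModType R) p q (F : 'rV[R]_p -> 'rV[R]_q)
    (Y : 'rV[R]_q -> W) (x : 'rV[R]_p) i :
  differentiable F x -> differentiable Y (F x) ->
  differentiable (fun z => Y (F z)) x /\
  partial i (fun z => Y (F z)) x =
    \sum_(a < q) partial i F x 0 a *: partial a Y (F x).
Proof.
move=> dF dY; have dc := differentiable_comp dF dY; split=> //.
by rewrite /partial deriveE// (diff_comp dF dY) /= diff_rV// -deriveE.
Qed.

Lemma derivable_line (W : normedModType R) (V : normedModType R) (f : V -> W)
    (z v : V) (s : R) : differentiable f (s *: v + z) ->
  is_derive s 1 (fun t : R => f (t *: v + z)) ('D_v f (s *: v + z)).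
Proof.
move=> df.
have E : (fun h : R => h^-1 *: (((fun t : R => f (t *: v + z)) \o shift s) (h *: 1) - f (s *: v + z)))
      = (fun h : R => h^-1 *: ((f \o shift (s *: v + z)) (h *: v) - f (s *: v + z))).
  apply/funext => h /=; rewrite /shift /=; congr (_ *: (f _ - _)).
  by have -> : h *: (1 : R) = h by [exact: mulr1]; rewrite scalerDl addrA.
have dv := @diff_derivable _ _ _ f _ v df.
by split; rewrite /derivable /derive E.
Qed.

Lemma mean_value_line (V : normedModType R) (f : V -> R) (z v : V) (h : R) :
  0 <= h -> (forall t, 0 <= t <= h -> differentiable f (t *: v + z)) ->
  exists2 t, 0 <= t <= h & f (h *: v + z) - f z = h * 'D_v f (t *: v + z).
Proof.
move=> h0 df.
have cf : {within `[0, h], continuous (fun t : R => f (t *: v + z))}.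
  apply: continuous_in_subspaceT => t; rewrite inE /= in_itv /= => /df dft.
  apply: differentiable_continuous; apply/derivable1_diffP.
  exact: (@ex_derive _ _ _ _ _ _ _ (derivable_line dft)).
have [|t + e] := @MVT_segment R _ (fun t : R => 'D_v f (t *: v + z)) 0 h h0 _ cf.
  move=> t; rewrite in_itv /= => /andP[/ltW t0 /ltW th].
  by apply: derivable_line; apply: df; rewrite t0.
rewrite in_itv /= => th; exists t => //.
by move: e; rewrite scale0r add0r subr0 mulrC.
Qed.

(** Two applications of the mean value theorem. The left-hand side is symmetric in v and w,
    the right-hand side is not: this is the source of [derive_swap]. *)
Lemma second_difference (V : normedModType R) (f : V -> R) (U : set V) (z v w : V) (h : R) :
  smooth_on U f -> 0 <= h ->
  (forall s t, 0 <= s <= h -> 0 <= t <= h -> U (t *: w + (s *: v + z))) ->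
  exists s t, [/\ 0 <= s <= h, 0 <= t <= h &
   f (h *: w + (h *: v + z)) - f (h *: w + z) - f (h *: v + z) + f z =
     h * (h * 'D_w (fun y => 'D_v f y) (t *: w + (s *: v + z)))].
Proof.
move=> fU h0 Ust.
have h0h : 0 <= h <= h by apply/andP.
have h00 : (0 : R) <= 0 <= h by apply/andP.
pose g y := f (h *: w + y) - f y.
have shiftf y : U (h *: w + y) -> differentiable (fun y => f (h *: w + y)) y /\
     'D_v (fun y => f (h *: w + y)) y = 'D_v f (h *: w + y).
  move=> Uy; have df := smooth_on_differentiable fU Uy.
  have ds : differentiable (fun y : V => h *: w + y) y.
    by apply: differentiableD; [exact: differentiable_cst|exact: ex_diff].
  have dc : differentiable (fun y => f (h *: w + y)) y by exact: (differentiable_comp ds df).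
  split=> //; rewrite deriveE// (diff_comp ds df) /= deriveE//; congr ('d f _ _).
  by rewrite -deriveE// deriveD// derive_cst derive_id add0r.
have dg y : U (h *: w + y) -> U y -> differentiable g y /\
     'D_v g y = 'D_v f (h *: w + y) - 'D_v f y.
  move=> U1 U2; have [d1 e1] := shiftf y U1; have d2 := smooth_on_differentiable fU U2.
  split; first exact: differentiableB.
  by rewrite deriveB ?e1//; exact: diff_derivable.
have U1 s : 0 <= s <= h -> U (h *: w + (s *: v + z)) by move=> sh; exact: Ust.
have U2 s : 0 <= s <= h -> U (s *: v + z).
  by move=> sh; have := Ust s 0 sh h00; rewrite scale0r add0r.
have [|s sh e] := @mean_value_line V g z v h h0.
  by move=> t th; have [] := dg _ (U1 _ th) (U2 _ th).
have [_ gE] := dg _ (U1 _ sh) (U2 _ sh).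
have fv : smooth_on U (fun y => 'D_v f y) by exact: smooth_on_derive.
have [|t th e'] := @mean_value_line V (fun y => 'D_v f y) (s *: v + z) w h h0.
  by move=> t th; apply: smooth_on_differentiable fv _; exact: Ust.
exists s, t; split=> //; rewrite -e' -gE -e /g; ring.
Qed.

Lemma parallelogram_in_ball (V : normedModType R) (z v w : V) (d : R) : 0 < d ->
  exists2 h : R, 0 < h & forall s t, 0 <= s <= h -> 0 <= t <= h ->
    ball z d (t *: w + (s *: v + z)) /\ ball z d (t *: v + (s *: w + z)).
Proof.
move=> d0; pose N := `|v| + `|w| + 1.
have N0 : 0 < N by rewrite /N ltr_wpDl ?addr_ge0 ?ltr01.
have h0 : 0 < d / 2 / N by rewrite !divr_gt0.
suff inb v' w' s t : `|v'| + `|w'| + 1 = N ->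
    0 <= s <= d / 2 / N -> 0 <= t <= d / 2 / N -> ball z d (t *: w' + (s *: v' + z)).
  exists (d / 2 / N) => // s t sh th; split; apply: inb => //.
  by rewrite (addrC `|w|).
move=> NE /andP[s0 sh] /andP[t0 th].
rewrite -ball_normE /= addrA [_ + z]addrC opprD addrA subrr add0r normrN.
apply: le_lt_trans (ler_normD _ _) _; rewrite !normrZ !ger0_norm//.
have: t * `|w'| <= d / 2 / N * `|w'| by rewrite ler_wpM2r.
have: s * `|v'| <= d / 2 / N * `|v'| by rewrite ler_wpM2r.
have: d / 2 / N * `|v'| + d / 2 / N * `|w'| + d / 2 / N = d / 2.
  by rewrite -mulrDr -[X in _ + X]mulr1 -mulrDr NE divfK// gt_eqF.
move: h0 d0; clear.
move: (d / 2 / N) (s * _) (t * _) => h a b.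
by move: (h * `|v'|) (h * `|w'|) => a' b'; clear; lra.
Qed.

Lemma close_to_common (a b c e : R) :
  `|a - c| <= e / 2 -> `|b - c| <= e / 2 -> `|a - b| <= e.
Proof.
move=> ac bc; rewrite (splitr e) -(subrK c a) -addrA -(opprB b).
by apply: le_trans (ler_normB _ _) _; rewrite lerD.
Qed.

(** Both mixed derivatives are limits of the same second difference quotient. *)
Lemma derive_swap (V : normedModType R) (f : V -> R) (U : set V) (z v w : V) :
  open U -> smooth_on U f -> U z ->
  'D_w (fun y => 'D_v f y) z = 'D_v (fun y => 'D_w f y) z.
Proof.
move=> oU fU Uz.
pose A y := 'D_w (fun y => 'D_v f y) y; pose B y := 'D_v (fun y => 'D_w f y) y.
have sA : smooth_on U A := smooth_on_derive w (smooth_on_derive v fU).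
have sB : smooth_on U B := smooth_on_derive v (smooth_on_derive w fU).
have cA : A @ z --> A z by exact: differentiable_continuous (smooth_on_differentiable sA Uz).
have cB : B @ z --> B z by exact: differentiable_continuous (smooth_on_differentiable sB Uz).
apply/eqP; rewrite -subr_eq0 -normr_eq0 -/(A z) -/(B z); apply/eqP.
apply/le_anti; rewrite normr_ge0 andbT; apply/ler_addgt0Pl => e e0; rewrite addr0.
have e2 : 0 < e / 2 by rewrite divr_gt0.
have /cvgrPdist_le/(_ _ e2) nA := cA; have /cvgrPdist_le/(_ _ e2) nB := cB.
have nU : \near z, U z by exact: open_nbhs_nbhs.
have /nbhs_ballP[d /= d0 ball_d] : nbhs z [set y | U y /\ (`|A z - A y| <= e / 2 /\ `|B z - B y| <= e / 2)].
  exact: (filterI nU (filterI nA nB)).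
have [h h0 inb] := parallelogram_in_ball z v w d0.
have [s [t [sh th E1]]] := second_difference fU (ltW h0) (fun s t sh th => (ball_d _ (inb s t sh th).1).1).
have [s' [t' [sh' th' E2]]] := second_difference fU (ltW h0) (fun s t sh th => (ball_d _ (inb s t sh th).2).1).
have [_ [+ _]] := ball_d _ (inb s t sh th).1.
have [_ [_ +]] := ball_d _ (inb s' t' sh' th').2.
have : A (t *: w + (s *: v + z)) = B (t' *: v + (s' *: w + z)).
  have hn0 : h != 0 by rewrite gt_eqF.
  do 2!apply: (mulfI hn0).
  apply: (etrans (esym E1)); apply: etrans E2.
  by rewrite (addrCA (h *: w)) [X in X + _ = _]addrAC.
move=> -> lB lA; exact: close_to_common lA lB.
Qed.

End DirectionalDerivatives.

(** * Scalar products *)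

Record scalar_product (R : realType) (E : normedModType R) (sp : E -> E -> R) :
    Prop := ScalarProduct {
  scalar_sym : forall x y, sp x y = sp y x;
  scalar_linear : forall z, linear (fun x => sp x z : R^o);
  scalar_continuous : continuous (fun p : E * E => sp p.1 p.2)
}.

(** The induced metric of a parametrization when sp is the scalar product of the ambient
    space; taking sp as a parameter lets the same lemmas serve the degenerate scalar products
    that see only one factor of a direct sum. *)
Definition gram (R : realType) (E : normedModType R) (sp : E -> E -> R) (q : nat)
    (Y : 'rV[R]_q -> E) (y : 'rV[R]_q) : 'M[R]_q :=
  \matrix_(i, j) sp (partial i Y y) (partial j Y y).

Section ScalarProduct.
Context {R : realType} {E : normedModType R} (sp : E -> E -> R).
Hypothesis spP : scalar_product sp.

Lemma scalarDl x y z : sp (x + y) z = sp x z + sp y z.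
Proof.
by have := scalar_linear spP z 1 x y; rewrite scale1r => ->; rewrite scale1r.
Qed.

Lemma scalar0l z : sp 0 z = 0.
Proof. by have := scalarDl 0 0 z; rewrite addr0 => /eqP; rewrite -subr_eq subrr eq_sym => /eqP. Qed.

Lemma scalarZl a x z : sp (a *: x) z = a * sp x z.
Proof. by have := scalar_linear spP z a x 0; rewrite addr0 scalar0l addr0. Qed.

Lemma scalarNl x z : sp (- x) z = - sp x z.
Proof. by rewrite -scaleN1r scalarZl mulN1r. Qed.

Lemma scalarBl x y z : sp (x - y) z = sp x z - sp y z.
Proof. by rewrite scalarDl scalarNl. Qed.

Lemma scalar_suml (I : finType) (P : pred I) (f : I -> E) z :
  sp (\sum_(i | P i) f i) z = \sum_(i | P i) sp (f i) z.
Proof.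
apply: (big_morph (fun x => sp x z)) => [x y|]; [exact: scalarDl|exact: scalar0l].
Qed.

Lemma scalarDr x y z : sp z (x + y) = sp z x + sp z y.
Proof. by rewrite !(scalar_sym spP z) scalarDl. Qed.

Lemma scalarZr a x z : sp z (a *: x) = a * sp z x.
Proof. by rewrite !(scalar_sym spP z) scalarZl. Qed.

Lemma scalar_sumr (I : finType) (P : pred I) (f : I -> E) z :
  sp z (\sum_(i | P i) f i) = \sum_(i | P i) sp z (f i).
Proof. by rewrite (scalar_sym spP) scalar_suml; apply: eq_bigr => i _; rewrite (scalar_sym spP). Qed.

Lemma derive_scalar (V : normedModType R) (f g : V -> E) x v :
  differentiable f x -> differentiable g x ->
  differentiable (fun y => sp (f y) (g y)) x /\
  'D_v (fun y => sp (f y) (g y)) x = sp ('D_v f x) (g x) + sp (f x) ('D_v g x).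
Proof.
move=> df dg.
have bilin : bilinear_for (GRing.Scale.Law.clone _ _ *:%R _)
    (GRing.Scale.Law.clone _ _ *:%R _) (sp : E -> E -> R^o).
  by split=> z a x' y'; rewrite ?scalarDr ?scalarZr// scalarDl scalarZl.
pose BM := bilinear_isBilinear.Build R E E R^o _ _ (sp : E -> E -> R^o) bilin.
pose B : {bilinear E -> E -> R^o} := HB.pack (sp : E -> E -> R^o) BM.
have cB : continuous (fun p : E * E => B p.1 p.2) := scalar_continuous spP.
have dp := differentiable_pair df dg.
have dB := differentiable_bilin (f x, g x) cB.
have dc : differentiable (fun y => sp (f y) (g y)) x := differentiable_comp dp dB.
split=> //; rewrite deriveE// (diff_comp dp dB) /= (diff_bilin _ cB) (diff_pair df dg) /=.
by rewrite -!deriveE// addrC.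
Qed.

Lemma scalar_linearlP z : exists2 L : {linear E -> R^o}, continuous L & forall x, L x = sp x z.
Proof.
pose LM := GRing.isLinear.Build R E R^o _ (fun x => sp x z : R^o) (scalar_linear spP z).
pose L : {linear E -> R^o} := HB.pack (fun x => sp x z : R^o) LM.
exists L => // x.
apply: (@continuous_comp _ _ _ (fun x : E => (x, z)) (fun p : E * E => sp p.1 p.2)).
  by apply: cvg_pair; [exact: cvg_id|exact: cvg_cst].
exact: scalar_continuous.
Qed.

End ScalarProduct.

(** * Differentiable matrix functions *)

Section DifferentiableMatrices.
Context {R : realType} {V : normedModType R}.

Lemma differentiable_bigsum (W : normedModType R) (I : finType) (P : pred I)
    (f : I -> V -> W) x :
  (forall i, P i -> differentiable (f i) x) ->
  differentiable (fun y => \sum_(i | P i) f i y) x.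
Proof.
move=> df; have -> : (fun y => \sum_(i | P i) f i y) = \sum_(i | P i) f i.
  by apply/funext => y; rewrite fct_sumE.
apply: (big_ind (fun g : V -> W => differentiable g x)) => //.
by move=> g1 g2; exact: differentiableD.
Qed.

Lemma differentiable_bigprod (I : finType) (f : I -> V -> R) x :
  (forall i, differentiable (f i) x) ->
  differentiable (fun y => \prod_i f i y) x.
Proof.
move=> df; suff K (s : seq I) : differentiable (fun y => \prod_(i <- s) f i y) x by exact: K.
elim: s => [|i s IHs].
  have -> : (fun y => \prod_(i <- [::]) f i y) = cst 1.
    by apply/funext => y; rewrite big_nil.
  exact: (@differentiable_cst R V R (1 : R) x).
have -> : (fun y => \prod_(j <- i :: s) f j y) = f i * (fun y => \prod_(j <- s) f j y).
  by apply/funext => y; rewrite big_cons.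
exact: differentiableM.
Qed.

Lemma differentiable_row n (f : V -> 'rV[R]_n) x :
  (forall i, differentiable (fun y => f y 0 i) x) -> differentiable f x.
Proof.
move=> df; have -> : f = fun y => \sum_i f y 0 i *: delta_mx 0 i.
  by apply/funext => y; exact: row_sum_delta.
by apply: differentiable_bigsum => i _; exact: differentiableZl.
Qed.

Lemma differentiable_entry n (f : V -> 'rV[R]_n) x i :
  differentiable f x -> differentiable (fun y => f y 0 i) x.
Proof.
move=> df; apply: (differentiable_comp df (differentiable_coord (f x) 0 i)).
Qed.

Lemma derive_entry n (f : V -> 'rV[R]_n) x v i :
  differentiable f x -> 'D_v (fun y => f y 0 i) x = 'D_v f x 0 i.
Proof. by move=> df; rewrite derive_mx ?mxE//; exact: diff_derivable. Qed.

Lemma differentiable_mull (c : R) (f : V -> R) x :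
  differentiable f x -> differentiable (fun y => c * f y) x.
Proof.
by move=> df; apply: (@differentiableM R V (cst c) f x) => //; exact: differentiable_cst.
Qed.

Lemma differentiable_det n (A : V -> 'M[R]_n) x :
  (forall i j, differentiable (fun y => A y i j) x) ->
  differentiable (fun y => \det (A y)) x.
Proof.
move=> dA; apply: differentiable_bigsum => s _.
apply: differentiable_mull.
by apply: differentiable_bigprod => i; exact: dA.
Qed.

(** Near a point where the determinant does not vanish, the inverse is given by the cofactors. *)
Lemma differentiable_invmx n (A : V -> 'M[R]_n) x i j :
  (forall i j, differentiable (fun y => A y i j) x) -> A x \in unitmx ->
  differentiable (fun y => invmx (A y) i j) x.
Proof.
move=> dA Ax; have dd := differentiable_det dA.
have d0 : \det (A x) != 0 by rewrite -unitfE.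
have E : \near x, (\det (A x))^-1 * cofactor (A x) j i = invmx (A x) i j.
  have : \near x, \det (A x) != 0.
    have op : open [set z : R | z != 0] by exact: open_neq.
    have := differentiable_continuous dd.
    by move/(_ _ (open_nbhs_nbhs (conj op d0))).
  apply: filterS => y dy; rewrite /invmx unitmxE unitfE dy.
  by rewrite !mxE.
apply: differentiable_near_eq E _.
apply: (@differentiableM _ _ (fun y => (\det (A y))^-1) (fun y => cofactor (A y) j i)).
  exact: differentiableV.
apply: differentiable_mull.
apply: differentiable_det => k l.
have -> : (fun y => row' j (col' i (A y)) k l) = (fun y => A y (lift j k) (lift i l)).
  by apply/funext => y; rewrite !mxE.
exact: dA.
Qed.

End DifferentiableMatrices.

Lemma differentiable_scale_fun {R : realType} {V W : normedModType R}
    (k : V -> R) (f : V -> W) x v :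
  differentiable k x -> differentiable f x ->
  differentiable (fun y => k y *: f y) x /\
  'D_v (fun y => k y *: f y) x = 'D_v k x *: f x + k x *: 'D_v f x.
Proof.
move=> dk df.
pose B := (@GRing.scale R W : R^o -> W -> W).
have bilin : bilinear_for (GRing.Scale.Law.clone _ _ *:%R _)
    (GRing.Scale.Law.clone _ _ *:%R _) B.
  split=> z a x' y'; rewrite /B /=.
    by rewrite scalerDl scalerA.
  by rewrite scalerDr !scalerA mulrC.
pose BM := bilinear_isBilinear.Build R R^o W W _ _ B bilin.
pose BL : {bilinear R^o -> W -> W} := HB.pack B BM.
have cB : continuous (fun p : R^o * W => BL p.1 p.2).
  by move=> p; exact: scale_continuous.
have dp := differentiable_pair dk df.
have dB := differentiable_bilin ((k x : R^o), f x) cB.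
have dc : differentiable (fun y => k y *: f y) x := differentiable_comp dp dB.
split=> //; rewrite deriveE// (diff_comp dp dB) /= (diff_bilin _ cB) (diff_pair dk df) /=.
by rewrite -!deriveE// addrC.
Qed.

(** * Immersions into a space with a scalar product *)

Lemma gramE (R : realType) (E : normedModType R) (sp : E -> E -> R) (q : nat)
    (Y : 'rV[R]_q -> E) (y : 'rV[R]_q) i j :
  gram sp Y y i j = sp (partial i Y y) (partial j Y y).
Proof. by rewrite mxE. Qed.

Section Immersion.
Context {R : realType} {E : normedModType R} (sp : E -> E -> R).
Hypothesis spP : scalar_product sp.
Variables (q : nat) (W : set 'rV[R]_q) (Y : 'rV[R]_q -> E).
Hypotheses (oW : open W) (smY : smooth_on W Y).

Lemma differentiable_partial a y : W y -> differentiable (partial a Y) y.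
Proof. by move=> Wy; exact: smooth_on_differentiable (smooth_on_derive _ smY) Wy. Qed.

Lemma differentiable_partial2 a b y : W y -> differentiable (partial a (partial b Y)) y.
Proof.
by move=> Wy; exact: smooth_on_differentiable (smooth_on_derive _ (smooth_on_derive _ smY)) Wy.
Qed.

(** Pairing with a fixed vector reduces the symmetry of second derivatives to scalar functions. *)
Lemma scalar_partial_swap a b y v : W y ->
  sp (partial a (partial b Y) y) v = sp (partial b (partial a Y) y) v.
Proof.
move=> Wy; have [L cL LE] := scalar_linearlP spP v.
have smL : smooth_on W (fun z => L (Y z) : R).
  apply/smooth_onP => n; apply: (@smooth_upto_linear R _ W oW _ _ n L) => //.
  by move/smooth_onP : smY; apply.
have K c d : sp (partial c (partial d Y) y) v =
    'D_(delta_mx 0 c) (fun z => 'D_(delta_mx 0 d) (fun z => L (Y z)) z) y.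
  rewrite -LE; have [_ <-] := derive_linear_comp (delta_mx 0 c) cL (differentiable_partial d Wy).
  apply: (derive_eq_on oW) => // z Wz; rewrite /partial.
  by have [_ <-] := derive_linear_comp (delta_mx 0 d) cL (smooth_on_differentiable smY Wz).
by apply: (etrans (K a b)); apply: (etrans _ (esym (K b a))); exact: derive_swap oW smL Wy.
Qed.

Lemma derive_gram a b c y : W y ->
  partial a (fun z => gram sp Y z b c) y =
    sp (partial a (partial b Y) y) (partial c Y y) +
    sp (partial b Y y) (partial a (partial c Y) y).
Proof.
move=> Wy; rewrite {1}/partial.
have -> : (fun z => gram sp Y z b c) = fun z => sp (partial b Y z) (partial c Y z).
  by apply/funext => z; rewrite mxE.
by have [_ ->] := derive_scalar spP (delta_mx 0 a) (differentiable_partial b Wy) (differentiable_partial c Wy).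
Qed.

Lemma differentiable_gram b c y : W y -> differentiable (fun z => gram sp Y z b c) y.
Proof.
move=> Wy; have -> : (fun z => gram sp Y z b c) = fun z => sp (partial b Y z) (partial c Y z).
  by apply/funext => z; rewrite mxE.
by have [] := derive_scalar spP 0 (differentiable_partial b Wy) (differentiable_partial c Wy).
Qed.

Lemma koszul_cancel (X : 'I_q -> E) (H : 'I_q -> 'I_q -> E) a b l :
  (forall c d v, sp (H c d) v = sp (H d c) v) ->
  sp (H a b) (X l) + sp (X b) (H a l) + (sp (H b a) (X l) + sp (X a) (H b l))
    - (sp (H l a) (X b) + sp (X a) (H l b)) = 2 * sp (H a b) (X l).
Proof.
move=> Hs; rewrite (scalar_sym spP (X b)) !(scalar_sym spP (X a)) (Hs b a) (Hs l a) (Hs l b).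
move: (sp (H a b) _) (sp (H a l) _) (sp (H b l) _) => r s t; clear.
ring.
Qed.

Lemma halve_double (r s t : R) : 2^-1 * r * (s * (2 * t)) = r * s * t.
Proof. by field. Qed.

Lemma gram_sym y a b : gram sp Y y a b = gram sp Y y b a.
Proof. by rewrite mxE mxE; exact: scalar_sym spP _ _. Qed.

Lemma invmx_gram y a c : gram sp Y y \in unitmx ->
  \sum_l gram sp Y y a l * invmx (gram sp Y y) l c = (a == c)%:R.
Proof. by move=> u; have := mulmxV u => /matrixP /(_ a c); rewrite !mxE. Qed.

(** The Levi-Civita connection of the induced metric is the tangential part of the
    derivative in the ambient space: the symmetry of second derivatives reduces the
    Koszul formula to one scalar product. *)
Lemma christoffel_gram a b c y : W y -> gram sp Y y \in unitmx ->
  \sum_k christoffel (gram sp Y) a b y 0 k * gram sp Y y k c =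
    sp (partial a (partial b Y) y) (partial c Y y).
Proof.
move=> Wy u.
have S l : partial a (fun z => gram sp Y z b l) y + partial b (fun z => gram sp Y z a l) y -
    partial l (fun z => gram sp Y z a b) y = 2 * sp (partial a (partial b Y) y) (partial l Y y).
  rewrite (derive_gram a b l Wy) (derive_gram b a l Wy) (derive_gram l a b Wy).
  exact: (@koszul_cancel (fun c => partial c Y y) (fun c d => partial c (partial d Y) y)
    a b l (fun c d v => scalar_partial_swap c d v Wy)).
transitivity (\sum_l (\sum_k gram sp Y y c k * invmx (gram sp Y y) k l) *
     sp (partial a (partial b Y) y) (partial l Y y)).
  under [RHS]eq_bigr do rewrite mulr_suml.
  rewrite exchange_big; apply: eq_bigr => k _.
  rewrite mxE mulrAC mulr_sumr; apply: eq_bigr => l _.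
  rewrite S (gram_sym y k c); exact: halve_double.
rewrite (bigD1 c) //= invmx_gram// eqxx mul1r big1 ?addr0// => l lc.
by rewrite invmx_gram// eq_sym (negbTE lc) mul0r.
Qed.

Section ConstantSquare.
Variable c : R.
Hypothesis sqY : forall y, W y -> sp (Y y) (Y y) = c.

(** A position vector of constant square is orthogonal to its derivatives. *)
Lemma partial_normal a y : W y -> sp (partial a Y y) (Y y) = 0.
Proof.
move=> Wy; have dY := smooth_on_differentiable smY Wy.
have [_ e] := derive_scalar spP (delta_mx 0 a) dY dY.
have : 'D_(delta_mx 0 a) (fun z => sp (Y z) (Y z)) y = 0.
  by rewrite (derive_eq_on oW (g := fun=> c) _ sqY Wy) derive_cst.
rewrite e (scalar_sym spP (Y y)) -mulr2n => /eqP; rewrite mulrn_eq0 /= => /eqP.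
exact.
Qed.

Lemma partial2_normal a b y : W y ->
  sp (partial a (partial b Y) y) (Y y) = - gram sp Y y a b.
Proof.
move=> Wy; have dY := smooth_on_differentiable smY Wy.
have [_ e] := derive_scalar spP (delta_mx 0 a) (differentiable_partial b Wy) dY.
have : 'D_(delta_mx 0 a) (fun z => sp (partial b Y z) (Y z)) y = 0.
  by rewrite (derive_eq_on oW (g := fun=> (0 : R)) _ (partial_normal b) Wy) derive_cst.
rewrite e => /eqP; rewrite addr_eq0 => /eqP; rewrite mxE (scalar_sym spP (partial a Y y)).
exact.
Qed.

End ConstantSquare.

Section Along.
Variables (p : nat) (F : 'rV[R]_p -> 'rV[R]_q).

Lemma near_in_domain x : differentiable F x -> W (F x) -> \near x, W (F x).
Proof.
by move=> dF WF; have := differentiable_continuous dF; apply; exact: open_nbhs_nbhs.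
Qed.

Lemma differential_near (V : 'rV[R]_p -> 'rV[R]_q) x :
  differentiable F x -> W (F x) ->
  \near x, \sum_a V x 0 a *: partial a Y (F x) = 'd Y (F x) (V x).
Proof.
move=> dF WF; apply: filterS (near_in_domain dF WF) => z Wz.
by rewrite diff_rV//; exact: smooth_on_differentiable smY Wz.
Qed.

(** The differential of Y reads a field V along F as a field of ambient vectors; its derivative
    has a part from V and a part from the motion of the frame. *)
Lemma derive_differential (V : 'rV[R]_p -> 'rV[R]_q) x i :
  differentiable F x -> W (F x) -> differentiable V x ->
  differentiable (fun z => 'd Y (F z) (V z)) x /\
  partial i (fun z => 'd Y (F z) (V z)) x =
    'd Y (F x) (partial i V x) +
    \sum_a \sum_b (partial i F x 0 a * V x 0 b) *: partial a (partial b Y) (F x).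
Proof.
move=> dF WF dV.
have near_sum := differential_near V dF WF.
have dt b : differentiable (fun z => V z 0 b *: partial b Y (F z)) x /\
   partial i (fun z => V z 0 b *: partial b Y (F z)) x =
     partial i V x 0 b *: partial b Y (F x) +
     \sum_a (partial i F x 0 a * V x 0 b) *: partial a (partial b Y) (F x).
  have dVb := differentiable_entry b dV.
  have [dYF eYF] := partial_comp i dF (differentiable_partial b WF).
  have [dZ eZ] := differentiable_scale_fun (delta_mx 0 i) dVb dYF.
  split=> //; rewrite {1}/partial eZ derive_entry//; congr (_ + _).
  apply: (etrans (congr1 (fun u => V x 0 b *: u) eYF)); rewrite scaler_sumr.
  by apply: eq_bigr => a _; rewrite scalerA mulrC.
split.
  apply: differentiable_near_eq near_sum _.
  by apply: differentiable_bigsum => b _; have [] := dt b.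
rewrite {1}/partial -(near_eq_derive _ near_sum).
have -> : (fun z => \sum_b V z 0 b *: partial b Y (F z)) = \sum_b (fun z => V z 0 b *: partial b Y (F z)).
  by apply/funext => z; rewrite fct_sumE.
rewrite derive_sum; last by move=> b; apply: diff_derivable; have [] := dt b.
rewrite diff_rV; last exact: smooth_on_differentiable smY WF.
rewrite exchange_big -big_split; apply: eq_bigr => b _.
exact: (dt b).2.
Qed.

Lemma scalar_differential y (v : 'rV[R]_q) c : W y ->
  sp ('d Y y v) (partial c Y y) = \sum_a v 0 a * gram sp Y y a c.
Proof.
move=> Wy; rewrite diff_rV; last exact: smooth_on_differentiable smY Wy.
by rewrite (scalar_suml spP); apply: eq_bigr => a _; rewrite (scalarZl spP) mxE.
Qed.

Lemma differential_components y (v : 'rV[R]_q) c : W y -> gram sp Y y \in unitmx ->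
  v 0 c = \sum_a sp ('d Y y v) (partial a Y y) * invmx (gram sp Y y) a c.
Proof.
move=> Wy u; transitivity ((v *m gram sp Y y *m invmx (gram sp Y y)) 0 c).
  by rewrite -mulmxA mulmxV// mulmx1.
by rewrite mxE; apply: eq_bigr => a _; rewrite scalar_differential// mxE.
Qed.

Lemma differential_inj y (v : 'rV[R]_q) : W y -> gram sp Y y \in unitmx -> 'd Y y v = 0 -> v = 0.
Proof.
move=> Wy u v0; apply/rowP => c; rewrite (differential_components v c Wy u) v0 mxE.
by apply: big1 => a _; rewrite (scalar0l spP) mul0r.
Qed.

(** The components of a tangent field are recovered from its ambient values by scalar products
    with the frame and the inverse Gram matrix, both of which are differentiable. *)
Lemma differentiable_components (V : 'rV[R]_p -> 'rV[R]_q) x :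
  (forall y, W y -> gram sp Y y \in unitmx) ->
  differentiable F x -> W (F x) ->
  differentiable (fun z => 'd Y (F z) (V z)) x -> differentiable V x.
Proof.
move=> u dF WF dP; apply: differentiable_row => c.
have E1 : \near x, \sum_a sp ('d Y (F x) (V x)) (partial a Y (F x)) *
       invmx (gram sp Y (F x)) a c = V x 0 c.
  apply: filterS (near_in_domain dF WF) => z Wz.
  by rewrite -differential_components//; exact: u.
apply: differentiable_near_eq E1 _; apply: differentiable_bigsum => a _.
have dpF := differentiable_comp dF (differentiable_partial a WF).
have dinv : differentiable (fun y => invmx (gram sp Y y) a c) (F x).
  apply: differentiable_invmx; last exact: u.
  by move=> i j; exact: differentiable_gram.
have [d1 _] := derive_scalar spP 0 dP dpF.
exact: (differentiableM d1 (differentiable_comp dF dinv)).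
Qed.

End Along.
End Immersion.

(** * Charts of a quadric of curvature -1 *)

Section Quadric.
Context {R : realType} {E : normedModType R} (sp : E -> E -> R).
Hypothesis spP : scalar_product sp.
Variables (q : nat) (W : set 'rV[R]_q) (Y : 'rV[R]_q -> E).
Hypotheses (oW : open W) (smY : smooth_on W Y).
Hypothesis unitY : forall y, W y -> sp (Y y) (Y y) = -1.
Hypothesis gramU : forall y, W y -> gram sp Y y \in unitmx.
Hypothesis spanY : forall y v, W y ->
  (forall a, sp v (partial a Y y) = 0) -> sp v (Y y) = 0 -> v = 0.

Let partial_normal a y : W y -> sp (partial a Y y) (Y y) = 0.
Proof. move=> Wy; exact: (partial_normal spP oW smY unitY a Wy). Qed.

(** Gauss formula: the position vector is the unit normal, and the second fundamental form
    equals the metric. *)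
Lemma gauss_formula a b y : W y ->
  partial a (partial b Y) y =
    'd Y y (christoffel (gram sp Y) a b y) + gram sp Y y a b *: Y y.
Proof.
move=> Wy; apply/eqP; rewrite -subr_eq0; apply/eqP; apply: (spanY Wy) => [c|].
  rewrite (scalarBl spP) (scalarDl spP) (scalarZl spP) (scalar_sym spP (Y y)) partial_normal//.
  rewrite mulr0 addr0 (scalar_differential spP smY)// (christoffel_gram spP oW smY)//.
    by rewrite subrr.
  exact: gramU.
rewrite (scalarBl spP) (scalarDl spP) (scalarZl spP) (partial2_normal spP oW smY unitY)// unitY//.
rewrite diff_rV; last exact: smooth_on_differentiable smY Wy.
rewrite (scalar_suml spP) big1 ?add0r ?mulrN1 ?subrr// => k _.
by rewrite (scalarZl spP) partial_normal// mulr0.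
Qed.

Lemma differential_normal y v : W y -> sp ('d Y y v) (Y y) = 0.
Proof.
move=> Wy; rewrite diff_rV; last exact: smooth_on_differentiable smY Wy.
by rewrite (scalar_suml spP) big1// => k _; rewrite (scalarZl spP) partial_normal// mulr0.
Qed.

Lemma scalar_differential2 y (v w : 'rV[R]_q) : W y ->
  sp ('d Y y v) ('d Y y w) = \sum_a \sum_b (v 0 a * w 0 b) * gram sp Y y a b.
Proof.
move=> Wy; have dY := smooth_on_differentiable smY Wy.
rewrite (diff_rV w dY) (scalar_sumr spP) exchange_big; apply: eq_bigr => b _.
rewrite (scalarZr spP) (scalar_differential spP smY)// mulr_sumr.
by apply: eq_bigr => a _; rewrite mulrCA mulrA.
Qed.

(** The covariant derivative along a map is the tangential projection of the derivative of
    the vector field read in the ambient space. *)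
Lemma differential_covd p (F V : 'rV[R]_p -> 'rV[R]_q) x i :
  differentiable F x -> W (F x) -> differentiable V x ->
  'd Y (F x) (covd (gram sp Y) F i V x) =
    partial i (fun z => 'd Y (F z) (V z)) x -
    sp ('d Y (F x) (V x)) ('d Y (F x) (partial i F x)) *: Y (F x).
Proof.
move=> dF WF dV; have [_ ->] := derive_differential oW smY i dF WF dV.
rewrite /covd linearD -addrA; congr (_ + _).
rewrite (scalar_sym spP) scalar_differential2// scaler_suml linear_sum -sumrB.
apply: eq_bigr => a _; rewrite scaler_suml linear_sum -sumrB.
apply: eq_bigr => b _; rewrite linearZ /= gauss_formula//.
by rewrite scalerDr !scalerA addrK.
Qed.

Lemma mul4_perm1 (a b c d : R) : a * b * c * d = a * c * d * b.
Proof. by ring. Qed.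

Lemma mul4_perm2 (a b c d : R) : a * b * c * d = b * c * d * a.
Proof. by ring. Qed.

(** In the antisymmetrization A - B of two second covariant derivatives, the third derivatives P
    and Q have the same scalar products, and the unknown normal components k and l cancel
    because A and B are tangent. *)
Lemma curvature_cancel (I : Type) (T : I -> E) (A B P Q u v N : E) (r s k l : R) :
  (forall z, (forall i, sp z (T i) = 0) -> sp z N = 0 -> z = 0) ->
  (forall i, sp (T i) N = 0) -> sp A N = 0 -> sp B N = 0 -> sp u N = 0 -> sp v N = 0 ->
  A = P - r *: u + k *: N -> B = Q - s *: v + l *: N ->
  (forall w, sp P w = sp Q w) -> A - B = s *: v - r *: u.
Proof.
move=> span TN AN BN uN vN AE BE PQ; apply: subr0_eq; apply: span => [i|].
  rewrite AE BE !(scalarDl spP, scalarNl spP, scalarZl spP) (scalar_sym spP N) TN PQ.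
  move: (sp Q _) (sp u _) (sp v _) => q' u' v'; clear; ring.
by rewrite !(scalarBl spP) AN BN !(scalarZl spP) uN vN !mulr0 !subr0.
Qed.

Lemma regroup_normal (P u N : E) (k s : R) :
  P - (k *: N + u) - s *: N = P - u + (- k - s) *: N.
Proof. by rewrite opprD scalerBl scaleNr !addrA; congr (_ - _); rewrite addrAC. Qed.

Lemma partial_id a y : partial a (@id 'rV[R]_q) y = delta_mx 0 a.
Proof. exact: derive_id. Qed.

Lemma differential_delta c y : W y -> 'd Y y (delta_mx 0 c) = partial c Y y.
Proof. by move=> Wy; rewrite /partial deriveE//; exact: smooth_on_differentiable smY Wy. Qed.

Lemma differential_partial_id a y : W y -> 'd Y y (partial a id y) = partial a Y y.
Proof. by move=> Wy; rewrite partial_id; exact: differential_delta. Qed.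

Lemma differential_covd_frame b c y : W y ->
  'd Y y (covd (gram sp Y) id b (fun=> delta_mx 0 c) y) =
    partial b (partial c Y) y - gram sp Y y c b *: Y y.
Proof.
move=> Wy; have did : differentiable (@id 'rV[R]_q) y by [].
have e : _ = partial b (fun z => 'd Y z (delta_mx 0 c)) y -
    sp ('d Y y (delta_mx 0 c)) ('d Y y (partial b id y)) *: Y y :=
  differential_covd b did Wy (differentiable_cst (delta_mx 0 c) y).
apply: (etrans e); congr (_ - _ *: _).
  by apply: (derive_eq_on oW) => // z Wz; exact: differential_delta.
rewrite (gramE sp Y y c b); congr (sp _ _); first exact: differential_delta.
exact: differential_partial_id.
Qed.

(** The coefficient k of the normal is left implicit: the tangency of the curvature eliminates it. *)
Lemma differential_covd_frame2 a b c y : W y ->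
  exists k, 'd Y y (covd (gram sp Y) id a (covd (gram sp Y) id b (fun=> delta_mx 0 c)) y) =
    partial a (partial b (partial c Y)) y - gram sp Y y b c *: partial a Y y + k *: Y y.
Proof.
move=> Wy; set T := covd _ id b _.
have TE z : W z -> partial b (partial c Y) z - gram sp Y z b c *: Y z = 'd Y z (T z).
  by move=> Wz; rewrite (gram_sym spP Y z b c) (differential_covd_frame b c Wz).
have dY := smooth_on_differentiable smY Wy.
have d2 := differentiable_partial2 smY b c Wy.
have [dg eg] := differentiable_scale_fun (delta_mx 0 a) (differentiable_gram spP smY b c Wy) dY.
have dS := differentiableB d2 dg.
have did : differentiable (@id 'rV[R]_q) y by [].
have dT : differentiable T y.
  apply: (differentiable_components spP oW smY (F := id)) => //.
  exact: (differentiable_eq_on oW TE Wy dS).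
have e : _ = partial a (fun z => 'd Y z (T z)) y -
    sp ('d Y y (T y)) ('d Y y (partial a id y)) *: Y y := differential_covd a did Wy dT.
have D : partial a (fun z => 'd Y z (T z)) y =
    partial a (partial b (partial c Y)) y -
    ('D_(delta_mx 0 a) (fun z => gram sp Y z b c) y *: Y y + gram sp Y y b c *: partial a Y y).
  have eB := @deriveB _ _ _ _ _ y (delta_mx 0 a) (diff_derivable d2) (diff_derivable dg).
  apply: (etrans (esym (derive_eq_on oW (delta_mx 0 a) TE Wy))); apply: (etrans eB).
  by congr (_ - _); exact: eg.
eexists; apply: (etrans e); apply: (etrans (congr1 (fun u => u - _ *: Y y) D)).
exact: regroup_normal.
Qed.

Lemma differential_curvature_frame a b c y : W y ->
  'd Y y (covd (gram sp Y) id a (covd (gram sp Y) id b (fun=> delta_mx 0 c)) y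
        - covd (gram sp Y) id b (covd (gram sp Y) id a (fun=> delta_mx 0 c)) y) =
  gram sp Y y a c *: partial b Y y - gram sp Y y b c *: partial a Y y.
Proof.
move=> Wy; rewrite linearB.
have [k e1] := differential_covd_frame2 a b c Wy.
have [l e2] := differential_covd_frame2 b a c Wy.
have smc : smooth_on W (partial c Y) := smooth_on_derive _ smY.
apply: (curvature_cancel (fun z => spanY (v := z) Wy) (fun d => partial_normal d Wy) _ _ _ _ e1 e2).
- exact: differential_normal.
- exact: differential_normal.
- exact: partial_normal.
- exact: partial_normal.
- by move=> w; exact (scalar_partial_swap spP oW smc a b w Wy).
Qed.

(** The quadric has constant sectional curvature -1. *)
Lemma differential_curvature y (A B C : 'rV[R]_q) : W y ->
  'd Y y (curvature (gram sp Y) y A B C) =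
    sp ('d Y y A) ('d Y y C) *: 'd Y y B - sp ('d Y y B) ('d Y y C) *: 'd Y y A.
Proof.
move=> Wy; have dY := smooth_on_differentiable smY Wy.
have [hA hB] : 'd Y y A = \sum_a A 0 a *: partial a Y y /\ 'd Y y B = \sum_a B 0 a *: partial a Y y.
  by split; rewrite diff_rV.
rewrite !scalar_differential2// hA hB {hA hB}.
transitivity (\sum_a \sum_b \sum_c
   ((A 0 a * C 0 c * gram sp Y y a c) *: (B 0 b *: partial b Y y) -
    (B 0 b * C 0 c * gram sp Y y b c) *: (A 0 a *: partial a Y y))).
  rewrite /curvature linear_sum; apply: eq_bigr => a _.
  rewrite linear_sum; apply: eq_bigr => b _; rewrite linear_sum; apply: eq_bigr => c _.
  apply: (etrans (linearZ _ _)).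
  apply: (etrans (congr1 (fun u => _ *: u) (differential_curvature_frame a b c Wy))).
  rewrite scalerBr !scalerA; congr (_ *: _ - _ *: _); [exact: mul4_perm1|exact: mul4_perm2].
under eq_bigr do under eq_bigr do rewrite sumrB.
under eq_bigr do rewrite sumrB.
rewrite sumrB; congr (_ - _).
  rewrite scaler_sumr exchange_big; apply: eq_bigr => b _.
  rewrite scaler_suml; apply: eq_bigr => a _; by rewrite scaler_suml.
rewrite scaler_sumr; apply: eq_bigr => a _.
by rewrite scaler_suml; apply: eq_bigr => b _; rewrite scaler_suml.
Qed.

End Quadric.

(** * Tension and bitension of a submanifold of the quadric *)

(** For the position vector of an immersion into a flat space, with g the induced metric,
    this is the second fundamental form. *)
Definition hessian (R : realType) (E : normedModType R) (p : nat)
    (g : 'rV[R]_p -> 'M[R]_p) (f : 'rV[R]_p -> E) (i j : 'I_p) (x : 'rV[R]_p) : E :=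
  partial i (partial j f) x - \sum_(k < p) christoffel g i j x 0 k *: partial k f x.

Lemma partial_linear (R : realType) (E E' : normedModType R) (p : nat)
    (U : set 'rV[R]_p) (X : 'rV[R]_p -> E) (L : {linear E -> E'}) i x :
  continuous L -> smooth_on U X -> U x ->
  partial i (fun z => L (X z)) x = L (partial i X x).
Proof.
move=> cL smX Ux.
by have [_ e] := derive_linear_comp (delta_mx 0 i) cL (smooth_on_differentiable smX Ux).
Qed.

Lemma hessian_linear (R : realType) (E E' : normedModType R) (p : nat)
    (U : set 'rV[R]_p) (X : 'rV[R]_p -> E) (g : 'rV[R]_p -> 'M[R]_p)
    (L : {linear E -> E'}) i j x :
  open U -> continuous L -> smooth_on U X -> U x ->
  hessian g (fun z => L (X z)) i j x = L (hessian g X i j x).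
Proof.
move=> oU cL smX Ux; apply: etrans (esym (linearB _ _ _)).
have e1 : partial i (partial j (fun z => L (X z))) x = L (partial i (partial j X) x).
  have sj : smooth_on U (partial j X) := smooth_on_derive _ smX.
  apply: (etrans _ (partial_linear i cL sj Ux)).
  by apply: (derive_eq_on oU) => // z Uz; exact: partial_linear cL smX Uz.
apply: (congr2 (fun u v => u - v) e1); rewrite linear_sum.
by apply: eq_bigr => k _; rewrite linearZ; congr (_ *: _); exact: partial_linear cL smX Ux.
Qed.

Section SubmanifoldOfQuadric.
Context {R : realType} {E : normedModType R} (sp : E -> E -> R).
Hypothesis spP : scalar_product sp.
Variables (q : nat) (W : set 'rV[R]_q) (Y : 'rV[R]_q -> E).
Hypotheses (oW : open W) (smY : smooth_on W Y).
Hypothesis unitY : forall y, W y -> sp (Y y) (Y y) = -1.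
Hypothesis gramU : forall y, W y -> gram sp Y y \in unitmx.
Hypothesis spanY : forall y v, W y ->
  (forall a, sp v (partial a Y y) = 0) -> sp v (Y y) = 0 -> v = 0.
Variables (p : nat) (U : set 'rV[R]_p) (X : 'rV[R]_p -> E) (F : 'rV[R]_p -> 'rV[R]_q).
Hypotheses (oU : open U) (smX : smooth_on U X) (smF : smooth_on U F).
Hypothesis FW : forall x, U x -> W (F x).
Hypothesis YF : forall x, U x -> Y (F x) = X x.
Hypothesis gramXU : forall x, U x -> gram sp X x \in unitmx.

Let g := gram sp X.
Let h := gram sp Y.
Let dF x : U x -> differentiable F x. Proof. exact: smooth_on_differentiable. Qed.

Lemma differential_partial i x : U x -> 'd Y (F x) (partial i F x) = partial i X x.
Proof.
move=> Ux; have dY := smooth_on_differentiable smY (FW Ux).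
have [_ e] := partial_comp i (dF Ux) dY.
apply: (etrans (diff_rV _ dY)); apply: (etrans (esym e)).
exact: (derive_eq_on oU) Ux.
Qed.

(** Form of [differential_covd] for fields known only through their ambient values, such as
    the tension field and its covariant derivatives: their differentiability is recovered from
    that of Z. *)
Lemma differential_covd_field (V : 'rV[R]_p -> 'rV[R]_q) (Z : 'rV[R]_p -> E) i x :
  (forall z, U z -> 'd Y (F z) (V z) = Z z) -> U x -> differentiable Z x ->
  'd Y (F x) (covd h F i V x) = partial i Z x - sp (Z x) (partial i X x) *: X x.
Proof.
move=> VZ Ux dZ.
have dV : differentiable V x.
  apply: (differentiable_components spP oW smY gramU (dF Ux) (FW Ux)).
  by apply: (differentiable_eq_on oU _ Ux dZ) => z Uz; rewrite VZ.
apply: (etrans (differential_covd spP oW smY unitY gramU spanY i (dF Ux) (FW Ux) dV)).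
congr (_ - sp _ _ *: _).
- exact: (derive_eq_on oU) Ux.
- exact: VZ.
- exact: differential_partial.
- exact: YF.
Qed.

Lemma differential_second_form i j x : U x ->
  'd Y (F x) (second_form g h F i j x) = hessian g X i j x - g x i j *: X x.
Proof.
move=> Ux; have dX := differentiable_partial smX j Ux.
apply: (etrans (linearB _ _ _)).
apply: (etrans (congr1 (fun u => u - _) (differential_covd_field i (differential_partial j) Ux dX))).
rewrite linear_sum (eq_bigr (fun k => christoffel g i j x 0 k *: partial k X x)); last first.
  by move=> k _; rewrite linearZ; congr (_ *: _); exact: differential_partial.
apply: (etrans (addrAC _ _ _)); congr (_ - _ *: _).
by apply: (etrans (scalar_sym spP _ _)); rewrite gramE.
Qed.

Lemma trace_gram x : U x -> \sum_i \sum_j invmx (g x) i j * g x i j = p%:R.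
Proof.
move=> Ux; transitivity (\sum_(i < p) (1 : R)); last first.
  by rewrite sumr_const card_ord.
apply: eq_bigr => i _; have := mulVmx (gramXU Ux) => /matrixP/(_ i i).
rewrite [LHS]mxE [RHS]mxE eqxx => e; apply: (etrans _ e); apply: eq_bigr => j _; congr (_ * _); exact: gram_sym.
Qed.

(** Beltrami's formula: the tension field is the tangential part of the Laplacian of the
    position vector. *)
Lemma differential_tension x : U x ->
  'd Y (F x) (tension g h F x) =
    \sum_i \sum_j invmx (g x) i j *: hessian g X i j x - p%:R *: X x.
Proof.
move=> Ux; rewrite -(trace_gram Ux) scaler_suml linear_sum -sumrB; apply: eq_bigr => i _.
rewrite scaler_suml linear_sum -sumrB; apply: eq_bigr => j _.
apply: (etrans (linearZ _ _)); rewrite -scalerA -scalerBr; congr (_ *: _).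
exact: differential_second_form.
Qed.

Section NormalTension.
Variable Z : 'rV[R]_p -> E.
Hypothesis smZ : smooth_on U Z.
Hypothesis tensionZ : forall x, U x -> 'd Y (F x) (tension g h F x) = Z x.
Hypothesis normalZ : forall x i, U x -> sp (Z x) (partial i X x) = 0.

Lemma differential_covd_tension i x : U x ->
  'd Y (F x) (covd h F i (tension g h F) x) = partial i Z x.
Proof.
move=> Ux; have dZ := smooth_on_differentiable smZ Ux.
apply: (etrans (differential_covd_field i tensionZ Ux dZ)).
by rewrite normalZ// scale0r subr0.
Qed.

Lemma differential_covd2_tension i j x : U x ->
  'd Y (F x) (covd h F i (covd h F j (tension g h F)) x -
     \sum_(k < p) christoffel g i j x 0 k *: covd h F k (tension g h F) x) =
  hessian g Z i j x - sp (partial j Z x) (partial i X x) *: X x.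
Proof.
move=> Ux; have dZ := differentiable_partial smZ j Ux.
apply: (etrans (linearB _ _ _)).
apply: (etrans (congr1 (fun u => u - _) (differential_covd_field i (differential_covd_tension j) Ux dZ))).
rewrite linear_sum (eq_bigr (fun k => christoffel g i j x 0 k *: partial k Z x)); last first.
  by move=> k _; rewrite linearZ; congr (_ *: _); exact: differential_covd_tension.
exact: addrAC.
Qed.

Lemma differential_trace_curvature x : U x ->
  'd Y (F x) (trace_metric g (fun i j y =>
      curvature h (F y) (partial i F y) (tension g h F y) (partial j F y)) x) =
  p%:R *: Z x.
Proof.
move=> Ux; rewrite -(trace_gram Ux) scaler_suml linear_sum; apply: eq_bigr => i _.
rewrite scaler_suml linear_sum; apply: eq_bigr => j _.
apply: (etrans (linearZ _ _)); rewrite -scalerA; congr (_ *: _).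
apply: (etrans (differential_curvature spP oW smY unitY gramU spanY _ _ _ (FW Ux))).
have -> : sp ('d Y (F x) (tension g h F x)) ('d Y (F x) (partial j F x)) = 0.
  by apply: etrans (normalZ j Ux); congr (sp _ _); [exact: tensionZ|exact: differential_partial].
rewrite scale0r subr0; congr (_ *: _); last exact: tensionZ.
by rewrite gramE; congr (sp _ _); exact: differential_partial.
Qed.

(** With a normal tension field Z, the rough Laplacian contributes the Laplacian of Z up to a
    normal term of the quadric, and the curvature -1 contributes p Z. *)
Lemma differential_bitension x : U x ->
  'd Y (F x) (bitension g h F x) =
    \sum_i \sum_j invmx (g x) i j *: hessian g Z i j x
    - (\sum_i \sum_j invmx (g x) i j * sp (partial j Z x) (partial i X x)) *: X x
    - p%:R *: Z x.
Proof.
move=> Ux; apply: (etrans (linearB _ _ _)).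
apply: (etrans (congr1 (fun u => _ - u) (differential_trace_curvature Ux))).
congr (_ - _); rewrite /rough_laplacian opprK.
rewrite scaler_suml linear_sum -sumrB; apply: eq_bigr => i _.
rewrite scaler_suml linear_sum -sumrB; apply: eq_bigr => j _.
apply: (etrans (linearZ _ _)); rewrite -scalerA -scalerBr; congr (_ *: _).
exact: differential_covd2_tension.
Qed.

End NormalTension.
End SubmanifoldOfQuadric.

(** * The Lorentz form *)

Definition lorentz_sign (R : realType) (k : nat) (i : 'I_k.+1) : R :=
  if i == ord_max then -1 else 1.

Section Lorentz.
Context {R : realType} {k : nat}.
Implicit Types y z : 'rV[R]_k.+1.

Lemma lorentzE y z : lorentz y z = \sum_i lorentz_sign R i * (y 0 i * z 0 i).
Proof.
rewrite /lorentz big_ord_recr /= /lorentz_sign eqxx mulN1r; congr (_ + _).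
apply: eq_bigr => i _; rewrite ifF ?mul1r//.
by apply/negbTE; rewrite -val_eqE /= ltn_eqF.
Qed.

Lemma lorentz_sym y z : lorentz y z = lorentz z y.
Proof. by rewrite !lorentzE; apply: eq_bigr => i _; rewrite (mulrC (y 0 i)). Qed.

Lemma lorentz_linear z : linear (fun y => lorentz y z : R^o).
Proof.
move=> a x y; rewrite !lorentzE scaler_sumr -big_split; apply: eq_bigr => i _ /=.
rewrite !mxE /GRing.scale /=; move: (x 0 i) (y 0 i) (z 0 i) (lorentz_sign _ _) => b c d e.
clear; ring.
Qed.

Lemma lorentz_delta y i : lorentz (delta_mx 0 i) y = lorentz_sign R i * y 0 i.
Proof.
rewrite lorentzE (bigD1 i) //= big1 ?addr0 => [|j ji].
  by rewrite mxE !eqxx mul1r.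
by rewrite mxE (negbTE ji) andbF mul0r mulr0.
Qed.

Lemma lorentz_sign_neq0 (i : 'I_k.+1) : lorentz_sign R i != 0.
Proof. by rewrite /lorentz_sign; case: ifP => _; rewrite ?oppr_eq0 oner_neq0. Qed.

Lemma lorentz_nondegenerate y : (forall z, lorentz y z = 0) -> y = 0.
Proof.
move=> y0; apply/rowP => i; rewrite mxE; have := y0 (delta_mx 0 i).
rewrite lorentz_sym lorentz_delta => /eqP.
by rewrite mulf_eq0 (negbTE (lorentz_sign_neq0 i)) /= => /eqP.
Qed.

Lemma lorentz0l z : lorentz 0 z = 0.
Proof. by rewrite lorentzE big1// => i _; rewrite mxE mul0r mulr0. Qed.

Definition space_sqr (y : 'rV[R]_k.+1) : R :=
  \sum_(i < k) y 0 (widen_ord (leqnSn k) i) ^+ 2.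

Lemma space_sqr_ge0 y : 0 <= space_sqr y.
Proof. by apply: sumr_ge0 => i _; exact: sqr_ge0. Qed.

Lemma lorentz_sqr y : lorentz y y = space_sqr y - y 0 ord_max ^+ 2.
Proof. by []. Qed.

Lemma space_sqr_eq0 y : space_sqr y = 0 -> y 0 ord_max = 0 -> y = 0.
Proof.
move=> /eqP; rewrite psumr_eq0 => [|i _]; last exact: sqr_ge0.
move=> /allP y0 ym; apply/rowP => i; rewrite mxE.
case: (unliftP ord_max i) => [j ->|-> //].
have := y0 j (mem_index_enum _); rewrite /= sqrf_eq0 => /eqP.
by move=> <-; congr (y 0 _); apply: val_inj; exact: lift_max.
Qed.

(** A vector orthogonal to a timelike vector is spacelike: a sum of squares expresses the
    reverse Cauchy-Schwarz inequality. *)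
Lemma lorentz_orthogonal_gt0 u z :
  lorentz u u < 0 -> lorentz z u = 0 -> z != 0 -> 0 < lorentz z z.
Proof.
rewrite !lorentz_sqr => uu zu z0.
set a := z 0 ord_max in zu *; set b := u 0 ord_max in uu zu *.
have := zu; rewrite /lorentz -/a -/b; set s := \sum_(i < k) _ => sab.
have b0 : 0 < b ^+ 2 by apply: le_lt_trans (space_sqr_ge0 u) _; rewrite -subr_lt0.
have zs := space_sqr_ge0 z.
have K : 0 <= b ^+ 2 * space_sqr z - 2 * a * b * s + a ^+ 2 * space_sqr u.
  have -> : b ^+ 2 * space_sqr z - 2 * a * b * s + a ^+ 2 * space_sqr u =
     \sum_(i < k) (b * z 0 (widen_ord (leqnSn k) i) - a * u 0 (widen_ord (leqnSn k) i)) ^+ 2.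
    rewrite /space_sqr /s !mulr_sumr -sumrB -big_split; apply: eq_bigr => i _ /=.
    by move: (z 0 _) (u 0 _) => c d; clear; ring.
  by apply: sumr_ge0 => i _; exact: sqr_ge0.
have [a0|a0] := eqVneq a 0.
  rewrite a0 expr0n /= subr0 lt_neqAle zs andbT eq_sym.
  by apply/eqP => z0'; move/eqP: z0; apply; exact: space_sqr_eq0.
have a2 : 0 < a ^+ 2 by rewrite exprn_even_gt0.
have : 0 < b ^+ 2 * (space_sqr z - a ^+ 2).
  move: uu K; have -> : s = a * b by apply/eqP; rewrite -subr_eq0 sab.
  move: (space_sqr z) (space_sqr u) a2 b0; clear => Z V a2 b0 uu K.
  have : 0 < a ^+ 2 * (b ^+ 2 - V) by rewrite mulr_gt0// subr_gt0 -subr_lt0.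
  nra.
by rewrite pmulr_rgt0.
Qed.

Lemma lorentz_orthogonal_ge0 u z : lorentz u u < 0 -> lorentz z u = 0 -> 0 <= lorentz z z.
Proof.
move=> uu zu; have [->|z0] := eqVneq z 0; first by rewrite lorentz0l.
exact/ltW/(lorentz_orthogonal_gt0 uu).
Qed.

Lemma continuous_lorentz (T : topologicalType) (f g : T -> 'rV[R]_k.+1) :
  continuous f -> continuous g -> continuous (fun x => lorentz (f x) (g x)).
Proof.
move=> cf cg x.
have entry (h : T -> 'rV[R]_k.+1) i : continuous h -> h y 0 i @[y --> x] --> h x 0 i.
  move=> ch; apply: (@continuous_comp _ _ _ h (fun M : 'rV[R]_k.+1 => M 0 i) x (ch x)).
  exact: coord_continuous.
rewrite /continuous_at lorentzE; under eq_fun do rewrite lorentzE.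
apply: cvg_big => [|i _]; first exact: add_continuous.
by apply: cvgM; [exact: cvg_cst|apply: cvgM; exact: entry].
Qed.

End Lorentz.

Lemma sum_scalar_product (R : realType) (m n : nat) : scalar_product (@sum_scalar R m n).
Proof.
split=> [x y|z a x y|].
- by rewrite /sum_scalar !(lorentz_sym x.1) !(lorentz_sym x.2).
- apply: (etrans (congr2 +%R (lorentz_linear z.1 a x.1 y.1) (lorentz_linear z.2 a x.2 y.2))).
  by rewrite /sum_scalar [in RHS](scalerDr a (lorentz x.1 z.1 : R^o)); exact: addrACA.
- move=> p; apply: cvgD.
  + apply: (@continuous_lorentz _ _ _ (fun q => q.1.1) (fun q => q.2.1)) => x.
      by apply: continuous_comp; exact: cvg_fst.
    by apply: continuous_comp; [exact: cvg_snd|exact: cvg_fst].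
  + apply: (@continuous_lorentz _ _ _ (fun q => q.1.2) (fun q => q.2.2)) => x.
      by apply: continuous_comp; [exact: cvg_fst|exact: cvg_snd].
    by apply: continuous_comp; exact: cvg_snd.
Qed.

(** * Tangent and normal frames *)

Section Frames.
Context {R : realType} {m n : nat}.
Local Notation E := ('rV[R]_m.+1 * 'rV[R]_n.+1)%type.
Local Notation sp := (@sum_scalar R m n).
Let spP : scalar_product sp := sum_scalar_product R m n.

Lemma sum_scalar_nondegenerate (v : E) : (forall w, sp v w = 0) -> v = 0.
Proof.
move=> v0; rewrite [v]surjective_pairing; congr (_, _); apply: lorentz_nondegenerate => z.
  by have := v0 (z, 0); rewrite /sum_scalar /= (lorentz_sym v.2) lorentz0l addr0.
by have := v0 (0, z); rewrite /sum_scalar /= (lorentz_sym v.1) lorentz0l add0r.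
Qed.

Definition combination k (b : 'I_k -> E) (c : 'rV[R]_k) : E := \sum_i c 0 i *: b i.

(** The matrix of a free family of full cardinality has full row rank. *)
Lemma free_family_spans k (b : 'I_k -> E) : k = (m.+1 + n.+1)%N ->
  (forall c, combination b c = 0 -> c = 0) -> forall w, exists c, w = combination b c.
Proof.
move=> kE free w.
pose vec (p : E) : 'rV[R]_(m.+1 + n.+1) := row_mx p.1 p.2.
pose S := \matrix_(i < k) vec (b i).
have SE c : c *m S = vec (combination b c).
  rewrite mulmx_sum_row; apply/rowP => j; rewrite summxE.
  have c1 : (combination b c).1 = \sum_i c 0 i *: (b i).1.
    by apply: (big_morph (fun p : E => p.1)).
  have c2 : (combination b c).2 = \sum_i c 0 i *: (b i).2.
    by apply: (big_morph (fun p : E => p.2)).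
  rewrite /vec; case: (split_ordP j) => l ->; rewrite ?row_mxEl ?row_mxEr ?c1 ?c2 summxE;
    by apply: eq_bigr => i _; rewrite rowK mxE ?row_mxEl ?row_mxEr mxE.
have Sfree : row_free S.
  apply: inj_row_free => c; rewrite SE => /(congr1 (fun M => (lsubmx M, rsubmx M))).
  rewrite /vec row_mxKl row_mxKr !linear0 => -[c1 c2]; apply: free.
  by rewrite [combination b c]surjective_pairing c1 c2.
have Sfull : row_full S by rewrite /row_full -{2}kE; exact: Sfree.
have /submxP[c cE] : (vec w <= S)%MS by exact: submx_full.
exists c; move: cE; rewrite SE /vec => /eq_row_mx[w1 w2].
by rewrite [w]surjective_pairing w1 w2 -surjective_pairing.
Qed.

Lemma scalar_combination k (b : 'I_k -> E) c d :
  sp (combination b c) (combination b d) =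
    (c *m (\matrix_(i, j) sp (b i) (b j)) *m d^T) 0 0.
Proof.
rewrite /combination (scalar_sumr spP) mxE; apply: eq_bigr => j _.
rewrite (scalarZr spP) (scalar_suml spP) !mxE mulrC; congr (_ * _).
by apply: eq_bigr => i _; rewrite (scalarZl spP) !mxE.
Qed.

Section TangentNormal.
Variables (k l : nat) (T : 'I_k -> E) (N : 'I_l -> E).
Hypothesis dimE : (k + l = m.+1 + n.+1)%N.
Hypothesis Tfree : forall c, combination T c = 0 -> c = 0.
Hypothesis NN : forall i j, i != j -> sp (N i) (N j) = 0.
Hypothesis Nneq0 : forall i, sp (N i) (N i) != 0.
Hypothesis TN : forall a i, sp (T a) (N i) = 0.

Lemma tangent_normal_spans w : exists c d, w = combination T c + combination N d.
Proof.
pose b (i : 'I_(k + l)) := match fintype.split i with inl a => T a | inr j => N j end.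
have bE c : combination b c = combination T (lsubmx c) + combination N (rsubmx c).
  rewrite /combination big_split_ord; congr (_ + _); apply: eq_bigr => i _; rewrite mxE /b.
    by have -> : fintype.split (lshift l i) = inl i := unsplitK (inl i).
  by have -> : fintype.split (rshift k i) = inr i := unsplitK (inr i).
suff free c : combination b c = 0 -> c = 0.
  by have [c ->] := free_family_spans dimE free w; exists (lsubmx c), (rsubmx c); rewrite bE.
rewrite bE => c0.
have r0 : rsubmx c = 0.
  apply/rowP => i; rewrite [RHS]mxE; have := congr1 (fun z => sp z (N i)) c0.
  rewrite (scalar0l spP) (scalarDl spP) !(scalar_suml spP) big1 => [|a _]; last first.
    by rewrite (scalarZl spP) TN mulr0.
  rewrite add0r (bigD1 i) //= big1 => [|j ji]; last by rewrite (scalarZl spP) (NN ji) mulr0.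
  by rewrite addr0 (scalarZl spP) => /eqP; rewrite mulf_eq0 (negbTE (Nneq0 i)) orbF => /eqP.
have l0 : lsubmx c = 0.
  apply: Tfree; move: c0; rewrite r0 /combination [X in _ + X]big1 ?addr0// => i _.
  by rewrite mxE scale0r.
by rewrite -[c]hsubmxK l0 r0 row_mx0.
Qed.

(** A free tangent family and an orthogonal normal family of complementary sizes form a basis,
    since pairing a relation with the normals isolates their coefficients. *)
Lemma tangent_normal_nondegenerate v :
  (forall a, sp v (T a) = 0) -> (forall i, sp v (N i) = 0) -> v = 0.
Proof.
move=> vT vN; apply: sum_scalar_nondegenerate => w.
have [c [d ->]] := tangent_normal_spans w.
rewrite (scalarDr spP) !(scalar_sumr spP) !big1 ?addr0// => i _; rewrite (scalarZr spP).
  by rewrite vN mulr0.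
by rewrite vT mulr0.
Qed.

Lemma tangent_gram_unit : (\matrix_(i, j) sp (T i) (T j)) \in unitmx.
Proof.
rewrite -row_free_unit; apply: inj_row_free => c c0; apply: Tfree.
apply: tangent_normal_nondegenerate => [a|i]; rewrite (scalar_suml spP); last first.
  by apply: big1 => a _; rewrite (scalarZl spP) TN mulr0.
move/rowP: c0 => /(_ a); rewrite !mxE => c0; apply: (etrans _ c0).
by apply: eq_bigr => b _; rewrite (scalarZl spP) mxE.
Qed.

Lemma normal_orthogonal_tangent z :
  (forall i, sp z (N i) = 0) -> exists c, z = combination T c.
Proof.
move=> zN; have [c [d zE]] := tangent_normal_spans z; exists c.
suff -> : z = combination T c + 0 by rewrite addr0.
rewrite {1}zE; congr (_ + _); apply: big1 => i _.
have := zN i; rewrite zE (scalarDl spP) !(scalar_suml spP) big1 => [|a _]; last first.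
  by rewrite (scalarZl spP) TN mulr0.
rewrite add0r (bigD1 i) //= big1 => [|j ji]; last by rewrite (scalarZl spP) (NN ji) mulr0.
rewrite addr0 (scalarZl spP) => /eqP; rewrite mulf_eq0 (negbTE (Nneq0 i)) orbF => /eqP ->.
by rewrite scale0r.
Qed.

Lemma tangent_normal_expansion v :
  v = \sum_i \sum_j (invmx (\matrix_(i, j) sp (T i) (T j)) i j * sp v (T i)) *: T j
      + \sum_i (sp v (N i) / sp (N i) (N i)) *: N i.
Proof.
set G := \matrix_(i, j) _; have GU : G \in unitmx := tangent_gram_unit.
apply/eqP; rewrite -subr_eq0; apply/eqP; apply: tangent_normal_nondegenerate => [a|i].
  rewrite (scalarBl spP) (scalarDl spP) !(scalar_suml spP) [X in _ - (_ + X)]big1 => [|i _]; last first.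
    by rewrite (scalarZl spP) [sp (N i) (T a)](scalar_sym spP) TN mulr0.
  rewrite addr0 (bigD1 a) //= [X in _ - (_ + X)]big1 => [|i ia].
    rewrite (scalar_suml spP) addr0; apply/eqP; rewrite subr_eq0; apply/eqP.
    transitivity ((invmx G *m G) a a * sp v (T a)); first by rewrite mulVmx// mxE eqxx mul1r.
    rewrite mxE mulr_suml; apply: eq_bigr => j _.
    by rewrite (scalarZl spP) mulrAC mxE.
  rewrite (scalar_suml spP); transitivity ((invmx G *m G) i a * sp v (T i)).
    rewrite mxE mulr_suml; apply: eq_bigr => j _.
    by rewrite (scalarZl spP) mulrAC mxE.
  by rewrite mulVmx// mxE (negbTE ia) mul0r.
rewrite (scalarBl spP) (scalarDl spP) !(scalar_suml spP) [X in _ - (X + _)]big1 => [|a _]; last first.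
  by rewrite (scalar_suml spP) big1// => b _; rewrite (scalarZl spP) TN mulr0.
rewrite add0r (bigD1 i) //= [X in _ - (_ + X)]big1 => [|j ji]; last by rewrite (scalarZl spP) (NN ji) mulr0.
by rewrite addr0 (scalarZl spP) divfK// subrr.
Qed.

End TangentNormal.
End Frames.

(** * Frames of the anti de Sitter space and of the product *)

Section AntiDeSitterFrame.
Context {R : realType} {m n : nat}.
Local Notation E := ('rV[R]_m.+1 * 'rV[R]_n.+1)%type.
Local Notation sp := (@sum_scalar R m n).
Let spP : scalar_product sp := sum_scalar_product R m n.
Variables (T : 'I_(m + n + 1) -> E) (x : E).
Hypothesis Tfree : forall c, combination T c = 0 -> c = 0.
Hypothesis xx : sp x x = -1.
Hypothesis Tx : forall a, sp (T a) x = 0.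

Let G := \matrix_(i, j) sp (T i) (T j).
Let dimE : (m + n + 1 + 1 = m.+1 + n.+1)%N. Proof. by rewrite !addn1 addSn addnS. Qed.
Let NN (i j : 'I_1) : i != j -> sp x x = 0.
Proof. by rewrite !ord1 eqxx. Qed.
Let N0 (i : 'I_1) : sp x x != 0.
Proof. by rewrite xx oppr_eq0 oner_neq0. Qed.
Let TN (a : 'I_(m + n + 1)) (i : 'I_1) : sp (T a) x = 0.
Proof. exact: Tx. Qed.

Lemma ads_frame_nondegenerate v : (forall a, sp v (T a) = 0) -> sp v x = 0 -> v = 0.
Proof.
by move=> vT vx; apply: (tangent_normal_nondegenerate dimE Tfree NN N0 TN vT).
Qed.

Lemma ads_gram_unit : G \in unitmx.
Proof. exact: (tangent_gram_unit dimE Tfree NN N0 TN). Qed.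

Lemma ads_tangent z : sp z x = 0 -> exists c, z = combination T c.
Proof. by move=> zx; apply: (normal_orthogonal_tangent dimE Tfree NN N0 TN). Qed.

Definition time_pair (p : E) : 'rV[R]_2 :=
  \row_(j < 2) if j == ord0 then p.1 0 ord_max else p.2 0 ord_max.

Lemma spacelike_ge0 p : time_pair p = 0 -> 0 <= sp p p.
Proof.
move=> /rowP p0; have := p0 ord0; have := p0 ord_max; rewrite !mxE /= => p2 p1.
by rewrite /sum_scalar !lorentz_sqr p1 p2 !expr0n /= !subr0 addr_ge0// space_sqr_ge0.
Qed.

Lemma time_pair_combination k (b : 'I_k -> E) c :
  time_pair (combination b c) = c *m \matrix_i time_pair (b i).
Proof.
apply/rowP => j; rewrite !mxE.
have e1 : (combination b c).1 = \sum_i c 0 i *: (b i).1.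
  by apply: (big_morph (fun p : E => p.1)).
have e2 : (combination b c).2 = \sum_i c 0 i *: (b i).2.
  by apply: (big_morph (fun p : E => p.2)).
by rewrite e1 e2 !summxE; case: ifP => j0; apply: eq_bigr => i _; rewrite !mxE j0.
Qed.

(** A plane of negative tangent vectors would, together with x, span a negative
    three-space, which the two timelike coordinates cannot separate. *)
Lemma ads_negative_rank (W : 'M[R]_(m + n + 1)) : negdef_on G W -> (\rank W <= 1)%N.
Proof.
move=> negW; rewrite leqNgt; apply/negP => rW.
pose r := \rank W; pose B := row_base W.
pose K := col_mx (B *m \matrix_i time_pair (T i)) (time_pair x).
have : kermx K != 0.
  rewrite kermx_eq0 /row_free neq_ltn; apply/orP; left.
  by apply: leq_ltn_trans (rank_leq_col _) _; rewrite -/r addn1 ltnS.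
move=> /rowV0Pn[w /sub_kermxP wK w0].
pose c := lsubmx w *m B; pose t := rsubmx w 0 0.
pose z := combination T c + t *: x.
have rE : rsubmx w = t%:M by rewrite [LHS]mx11_scalar.
have tz : time_pair z = 0.
  have -> : time_pair z = time_pair (combination T c) + t *: time_pair x.
    have [z1 z2] : z.1 = (combination T c).1 + t *: x.1 /\ z.2 = (combination T c).2 + t *: x.2.
      by [].
    by apply/rowP => j; rewrite [LHS]mxE z1 z2 !mxE; case: ifP.
  rewrite time_pair_combination -mulmxA -mul_scalar_mx -rE.
  by rewrite -mul_row_col hsubmxK.
have := spacelike_ge0 tz.
have cx : sp (combination T c) x = 0.
  by rewrite (scalar_suml spP) big1// => a _; rewrite (scalarZl spP) Tx mulr0.
have -> : sp z z = sp (combination T c) (combination T c) - t ^+ 2.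
  rewrite /z !(scalarDl spP) !(scalarDr spP) !(scalarZl spP) !(scalarZr spP) xx.
  by rewrite (scalar_sym spP x) cx mulr0 addr0 add0r mulrN1 mulrN expr2.
have [c0|c0] := eqVneq c 0.
  have l0 : lsubmx w = 0.
    by apply: (row_free_inj (row_base_free W)); rewrite mul0mx.
  have t0 : t != 0.
    apply: contraNneq w0 => t0; rewrite -[w]hsubmxK l0 rE t0.
    by rewrite raddf0 row_mx0.
  have -> : combination T c = 0 by rewrite c0; apply: big1 => i _; rewrite mxE scale0r.
  by rewrite (scalar0l spP) sub0r oppr_ge0 leNgt exprn_even_gt0 ?t0.
rewrite scalar_combination subr_ge0 leNgt => /negP; apply.
apply: lt_le_trans (sqr_ge0 _); apply: negW => //.
by apply: submx_trans (submxMl _ _) _; rewrite eq_row_base.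
Qed.

(** The negative plane of the two time axes meets the hyperplane orthogonal to x in a line. *)
Lemma ads_negative_line : exists W, \rank W = 1%N /\ negdef_on G W.
Proof.
set a := x.1 0 ord_max; set b := x.2 0 ord_max.
pose z : E := (b *: delta_mx 0 ord_max, - a *: delta_mx 0 ord_max).
have ab : 0 < a ^+ 2 + b ^+ 2.
  rewrite -oppr_lt0; apply: le_lt_trans (_ : sp x x < 0); last by rewrite xx ltrN10.
  rewrite /sum_scalar !lorentz_sqr -/a -/b.
  have := space_sqr_ge0 x.1; have := space_sqr_ge0 x.2.
  move: (space_sqr _) (space_sqr _) => s t; lra.
have dl k (y : 'rV[R]_k.+1) c : lorentz (c *: delta_mx 0 ord_max) y = - (c * y 0 ord_max).
  have := lorentz_linear y c (delta_mx 0 ord_max) 0.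
  by rewrite addr0 lorentz0l addr0 lorentz_delta /lorentz_sign eqxx mulN1r => ->; rewrite /GRing.scale /= mulrN.
have zx : sp z x = 0 by rewrite /sum_scalar !dl -/a -/b mulNr opprK mulrC addNr.
have zz : sp z z < 0.
  rewrite /sum_scalar !dl !mxE !eqxx !mulr1 mulrNN -opprD oppr_lt0.
  by rewrite addrC -!expr2.
have [c zE] := ads_tangent zx.
have c0 : c != 0.
  by apply/eqP => c0; move: zz; rewrite zE c0 /combination big1 ?(scalar0l spP) ?ltxx// => i _; rewrite mxE scale0r.
exists <<c>>%MS; split; first by rewrite mxrank_gen rank_rV c0.
move=> v v0; rewrite genmxE => /sub_rVP[s vE].
have s0 : s != 0 by apply: contraNneq v0 => s0; rewrite vE s0 scale0r.
rewrite vE -scalemxAl -scalemxAl mxE linearZ /= -scalemxAr mxE -scalar_combination -zE.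
by rewrite mulrA pmulr_rlt0// -expr2 exprn_even_gt0.
Qed.

Lemma ads_gram_index : has_index G 1.
Proof. split; [exact: ads_negative_line|exact: ads_negative_rank]. Qed.

End AntiDeSitterFrame.

Section HyperbolicProductFrame.
Context {R : realType} {m n : nat}.
Local Notation E := ('rV[R]_m.+1 * 'rV[R]_n.+1)%type.
Local Notation sp := (@sum_scalar R m n).
Let spP : scalar_product sp := sum_scalar_product R m n.
Variables (T : 'I_(m + n) -> E) (x : E).
Hypothesis Tfree : forall c, combination T c = 0 -> c = 0.
Hypothesis x1 : lorentz x.1 x.1 = - 2^-1.
Hypothesis x2 : lorentz x.2 x.2 = - 2^-1.
Hypothesis T1 : forall a, lorentz (T a).1 x.1 = 0.
Hypothesis T2 : forall a, lorentz (T a).2 x.2 = 0.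

Let G := \matrix_(i, j) sp (T i) (T j).
Let N (i : 'I_2) : E := if i == ord0 then (x.1, 0) else (0, x.2).
Let dimE : (m + n + 2 = m.+1 + n.+1)%N. Proof. by rewrite addn2 addSn addnS. Qed.
Let half_lt0 : - 2^-1 < 0 :> R. Proof. by rewrite oppr_lt0 invr_gt0. Qed.

Let spN0 v : sp v (N ord0) = lorentz v.1 x.1.
Proof. by rewrite /sum_scalar /N /= (lorentz_sym v.2) lorentz0l addr0. Qed.
Let spN1 v i : i != ord0 -> sp v (N i) = lorentz v.2 x.2.
Proof. by move=> i0; rewrite /sum_scalar /N (negbTE i0) /= (lorentz_sym v.1) lorentz0l add0r. Qed.

Let NN i j : i != j -> sp (N i) (N j) = 0.
Proof.
case: (eqVneq j ord0) => [->|j0].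
  by rewrite spN0 /N => /negbTE ->; rewrite lorentz0l.
rewrite spN1// /N; case: ifP => [_ _|i0 ij]; first by rewrite lorentz0l.
exfalso; move: i j ij i0 j0; clear.
by move=> [[|[|i]] //= ?] [[|[|j]] //= ?].
Qed.

Let NiNi i : sp (N i) (N i) = - 2^-1.
Proof.
case: (eqVneq i ord0) => [->|i0]; first by rewrite spN0.
by rewrite spN1// /N (negbTE i0).
Qed.
Let N0 i : sp (N i) (N i) != 0.
Proof. by rewrite NiNi lt_eqF. Qed.
Let TN a i : sp (T a) (N i) = 0.
Proof. by case: (eqVneq i ord0) => [->|i0]; rewrite ?spN0 ?spN1. Qed.

Lemma hyperbolic_frame_nondegenerate v :
  (forall a, sp v (T a) = 0) -> lorentz v.1 x.1 = 0 -> lorentz v.2 x.2 = 0 -> v = 0.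
Proof.
move=> vT v1 v2; apply: (tangent_normal_nondegenerate dimE Tfree NN N0 TN vT) => i.
by case: (eqVneq i ord0) => [->|i0]; rewrite ?spN0 ?spN1.
Qed.

Lemma hyperbolic_gram_unit : G \in unitmx.
Proof. exact: (tangent_gram_unit dimE Tfree NN N0 TN). Qed.

Lemma hyperbolic_gram_posdef : posdef G.
Proof.
move=> v v0; rewrite -scalar_combination; set z := combination T v.
have z0 : z != 0 by apply: contraNneq v0 => /Tfree/eqP.
have z1 : lorentz z.1 x.1 = 0.
  rewrite -spN0 (scalar_suml spP) big1// => a _.
  by rewrite (scalarZl spP) TN mulr0.
have z2 : lorentz z.2 x.2 = 0.
  rewrite -(@spN1 _ ord_max)// (scalar_suml spP) big1// => a _.
  by rewrite (scalarZl spP) TN mulr0.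
have x1' : lorentz x.1 x.1 < 0 by rewrite x1.
have x2' : lorentz x.2 x.2 < 0 by rewrite x2.
rewrite /sum_scalar; have [z10|z10] := eqVneq z.1 0.
  rewrite z10 lorentz0l add0r; apply: (lorentz_orthogonal_gt0 x2' z2).
  by apply: contraNneq z0 => z20; apply/eqP; rewrite [LHS]surjective_pairing z10 z20.
apply: ltr_pwDl; first exact: (lorentz_orthogonal_gt0 x1' z1).
exact: (lorentz_orthogonal_ge0 x2' z2).
Qed.

Let expansion (v : E) : v = \sum_i \sum_j (invmx G i j * sp v (T i)) *: T j
   + (- 2 * lorentz v.1 x.1 *: N ord0 + - 2 * lorentz v.2 x.2 *: N ord_max).
Proof.
have := tangent_normal_expansion dimE Tfree NN N0 TN v; rewrite -/G => e.
rewrite [LHS]e; congr (_ + _); rewrite big_ord_recl big_ord1 /=.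
have -> : lift ord0 ord0 = ord_max :> 'I_2 by apply: val_inj.
by rewrite !NiNi spN0 spN1// invrN invrK ![_ * - 2]mulrC.
Qed.

(** The diagonal entries of the expansion of the unit vectors of one factor add up to the
    dimension of that factor, of which the normal direction accounts for one. *)
Lemma hyperbolic_trace1 : \sum_i \sum_j invmx G i j * lorentz (T i).1 (T j).1 = m%:R.
Proof.
have e i : 1 = \sum_a \sum_b invmx G a b * (lorentz_sign R i * ((T a).1 0 i * (T b).1 0 i))
    - 2 * (lorentz_sign R i * (x.1 0 i * x.1 0 i)).
  have /(congr1 (fun v : E => v.1 0 i)) := expansion (delta_mx 0 i, 0).
  rewrite /= mxE !eqxx => e; apply: (etrans e) => {e}.
  rewrite !mxE; congr (_ + _).
    rewrite (_ : (\sum_a _).1 = \sum_a (\sum_b (invmx G a b * sp (delta_mx 0 i, 0) (T a)) *: T b).1); last first.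
      by apply: (big_morph (fun p : E => p.1)).
    rewrite summxE; apply: eq_bigr => a _.
    rewrite (_ : (\sum_b _).1 = \sum_b ((invmx G a b * sp (delta_mx 0 i, 0) (T a)) *: T b).1); last first.
      by apply: (big_morph (fun p : E => p.1)).
    rewrite summxE; apply: eq_bigr => b _; rewrite mxE /sum_scalar /= lorentz0l addr0 lorentz_delta.
    by rewrite -!mulrA.
  rewrite /N /= lorentz0l mulr0 addr0 lorentz_delta.
  by rewrite !mulNr -!mulrA.
have : \sum_(i < m.+1) (1 : R) = m.+1%:R by rewrite sumr_const card_ord.
rewrite (eq_bigr _ (fun i _ => e i)) sumrB -mulr_sumr -lorentzE x1 mulrN mulfV// opprK.
rewrite -natr1 => /addIr <-; rewrite [RHS]exchange_big; apply: eq_bigr => a _.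
by rewrite [RHS]exchange_big; apply: eq_bigr => b _; rewrite lorentzE mulr_sumr.
Qed.

Lemma hyperbolic_trace2 : \sum_i \sum_j invmx G i j * lorentz (T i).2 (T j).2 = n%:R.
Proof.
have : \sum_i \sum_j invmx G i j * sp (T i) (T j) = (m + n)%:R.
  transitivity (\sum_(i < m + n) (1 : R)); last by rewrite sumr_const card_ord.
  apply: eq_bigr => i _; have := mulVmx hyperbolic_gram_unit => /matrixP/(_ i i).
  rewrite [LHS]mxE [RHS]mxE eqxx => e; apply: (etrans _ e); apply: eq_bigr => j _.
  by rewrite mxE (scalar_sym spP).
rewrite natrD -hyperbolic_trace1 => e; apply: (addrI (\sum_i \sum_j invmx G i j * lorentz (T i).1 (T j).1)).
rewrite -e -big_split; apply: eq_bigr => i _; rewrite -big_split; apply: eq_bigr => j _ /=.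
by rewrite -mulrDr.
Qed.

End HyperbolicProductFrame.

(** * Graph charts *)

Section Charts.
Context {R : realType}.

Lemma linear_mapP (V W : lmodType R) (f : V -> W) :
  linear f -> exists L : {linear V -> W}, (L : V -> W) = f.
Proof.
move=> lf; pose LM := GRing.isLinear.Build R V W _ f lf.
by exists (HB.pack f LM : {linear V -> W}).
Qed.

Lemma linear_continuous_rV (W : normedModType R) n (f : 'rV[R]_n -> W) :
  linear f -> continuous f.
Proof. by move=> /linear_mapP[L <-]; exact: continuous_linear_rV. Qed.

Lemma linear_continuous_rV2 (W : normedModType R) m n (f : 'rV[R]_m * 'rV[R]_n -> W) :
  linear f -> continuous f.
Proof.
move=> lf; have l1 : linear (fun y : 'rV[R]_m => f (y, 0)).
  by move=> a x y; rewrite -lf; congr f; congr (_, _); rewrite /= scaler0 addr0.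
have l2 : linear (fun y : 'rV[R]_n => f (0, y)).
  by move=> a x y; rewrite -lf; congr f; congr (_, _); rewrite /= scaler0 addr0.
have fE : f = fun p => f (p.1, 0) + f (0, p.2).
  apply/funext => -[p1 p2] /=; have := lf 1 (p1, 0) (0, p2); rewrite !scale1r => <-.
  by congr f; congr (_, _); rewrite /= ?addr0 ?add0r.
rewrite fE => p; apply: cvgD.
  apply: (@continuous_comp _ _ _ (fun p => p.1) (fun y => f (y, 0)) p); first exact: cvg_fst.
  exact: linear_continuous_rV l1 _.
apply: (@continuous_comp _ _ _ (fun p => p.2) (fun y => f (0, y)) p); first exact: cvg_snd.
exact: linear_continuous_rV l2 _.
Qed.

Lemma smooth_upto_comp_linear (V W W' : normedModType R) n (U : set V) (f : W -> W') (g : V -> W) :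
  open U -> linear f -> continuous f -> smooth_upto n U g ->
  smooth_upto n U (fun x => f (g x)).
Proof. by move=> oU /linear_mapP[L <-]; exact: smooth_upto_linear. Qed.

Lemma smooth_upto_scale (V W : normedModType R) n (U : set V) (s : V -> R) (e : W) :
  open U -> smooth_upto n U s -> smooth_upto n U (fun x => s x *: e).
Proof.
move=> oU; apply: (@smooth_upto_comp_linear V R^o W n U (fun a : R^o => a *: e)) => //.
  by move=> a x y; rewrite scalerDl scalerA.
by move=> x; apply: cvgZr_tmp; exact: cvg_id.
Qed.

Lemma smooth_upto_sum (V W : normedModType R) n (U : set V) (I : finType) (f : I -> V -> W) :
  open U -> (forall i, smooth_upto n U (f i)) ->
  smooth_upto n U (fun x => \sum_i f i x).
Proof.
move=> oU sf; suff K (s : seq I) : smooth_upto n U (fun x => \sum_(i <- s) f i x) by exact: K.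
elim: s => [|i s IHs].
  by apply: (smooth_upto_eq oU _ (smooth_upto_cst oU n (0 : W))) => x _; rewrite big_nil.
apply: (smooth_upto_eq oU _ (smooth_uptoD oU (sf i) IHs)) => x _.
by rewrite big_cons.
Qed.

(** Differentiating pi (X x) = x makes the differential of X injective, and X @` W is the
    trace on the submanifold of the open set pi @^-1` W. *)
Lemma graph_local_param (S : subspace_data R) (U : set 'rV[R]_(sdim S))
    (X : 'rV[R]_(sdim S) -> ambient S) (pi : ambient S -> 'rV[R]_(sdim S))
    (O : set (ambient S)) :
  linear pi -> continuous pi -> open U -> smooth_on U X ->
  (forall x, U x -> pi (X x) = x) -> open O -> X @` U = carrier S `&` O ->
  local_param (M := S) U X.
Proof.
move=> lpi cpi oU smX piX oO XU; split=> //.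
- move=> x Ux; have [L LE] := linear_mapP lpi; have dX := smooth_on_differentiable smX Ux.
  have cL : continuous L by rewrite LE.
  have left v : L ('d X x v) = v.
    rewrite -deriveE//; have [_ <-] := derive_linear_comp v cL dX.
    by rewrite (derive_eq_on oU (g := id) _ _ Ux) ?derive_id// => z Uz; rewrite LE piX.
  exact: can_inj left.
- by move=> x y; rewrite !inE => Ux Uy XY; rewrite -(piX x Ux) -(piX y Uy) XY.
- move=> W oW WU; exists (O `&` pi @^-1` W).
    by apply: openI => //; apply: open_comp => // z _; exact: cpi.
  apply/seteqP; split=> [_ [x Wx <-]|p [Cp [Op Wp]]].
    have : (carrier S `&` O) (X x) by rewrite -XU; exists x => //; exact: WU.
    by move=> [? ?]; split=> //; split=> //=; rewrite piX//; exact: WU.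
  have : (X @` U) p by rewrite XU.
  by move=> [x Ux Xx]; exists x => //; rewrite -(piX x Ux) Xx.
Qed.

Lemma smooth_upto_subset (V W : normedModType R) n (U U' : set V) (f : V -> W) :
  (forall x, U x -> U' x) -> smooth_upto n U' f -> smooth_upto n U f.
Proof.
move=> sub; elim: n f => [|n IHn] f [df fn]; split=> //; try by move=> x /sub; exact: df.
by move=> v; apply: IHn; exact: fn.
Qed.

(** A quadric t^2 = 1 + Q, with Q a function of the coordinates complementary to t, is away
    from t = 0 the union of the graphs of the two square roots. *)
Lemma square_root_chart (S : subspace_data R) (Q : 'rV[R]_(sdim S) -> R)
    (pi : ambient S -> 'rV[R]_(sdim S)) (iota : 'rV[R]_(sdim S) -> ambient S)
    (t : ambient S -> R) (e : ambient S) (eps : R) :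
  (forall n, smooth_upto n setT Q) ->
  linear pi -> continuous pi -> linear iota -> continuous t ->
  (forall x s, pi (iota x + s *: e) = x) -> (forall x s, t (iota x + s *: e) = s) ->
  (forall p, p = iota (pi p) + t p *: e) ->
  (forall p, carrier S p <-> t p ^+ 2 = 1 + Q (pi p)) ->
  eps * eps = 1 ->
  let U := [set x | 0 < 1 + Q x] in
  let X x := iota x + (eps * Num.sqrt (1 + Q x)) *: e in
  local_param (M := S) U X /\ (X @` U = carrier S `&` [set p | 0 < eps * t p]).
Proof.
move=> smQ lpi cpi liota ct pi_i t_i pE CE ee U X.
have dQ x : differentiable Q x by have [+ _] := smQ 0%N; apply.
have oU : open U.
  have -> : U = (fun x => 1 + Q x) @^-1` [set y | 0 < y] by [].
  apply: open_comp; last exact: open_gt.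
  move=> x _; apply: differentiable_continuous.
  by apply: differentiableD; [exact: differentiable_cst|exact: dQ].
have e0 : eps != 0 by apply/eqP => e0; move/eqP: ee; rewrite e0 mul0r eq_sym oner_eq0.
have smX : smooth_on U X.
  have sQ n : smooth_upto n U (fun x => 1 + Q x).
    exact: (smooth_uptoD oU (smooth_upto_cst oU n (1 : R)) (smooth_upto_subset (fun x _ => I) (smQ n))).
  apply/smooth_onP => n; apply: (smooth_uptoD oU).
    apply: smooth_upto_comp_linear (smooth_upto_id oU n) => //.
    exact: linear_continuous_rV.
  apply: (smooth_upto_scale _ oU); apply: (smooth_uptoM oU (smooth_upto_cst oU n eps)).
  by apply: smooth_upto_sqrt.
have XU : X @` U = carrier S `&` [set p | 0 < eps * t p].
  apply/seteqP; split=> [_ [x Ux <-]|p [/CE Cp tp]].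
    split; last by rewrite /= t_i mulrA ee mul1r sqrtr_gt0.
    by apply/CE; rewrite t_i pi_i exprMn expr2 ee mul1r sqr_sqrtr// ltW.
  have Up : U (pi p).
    by rewrite /U /= -Cp exprn_even_gt0//=; apply: contraTneq tp => ->; rewrite mulr0 ltxx.
  exists (pi p) => //; rewrite /X [RHS]pE; congr (_ + _ *: _).
  rewrite -Cp -[t p ^+ 2]mul1r -[1](expr1n _ 2) -ee.
  have -> : (eps * eps) ^+ 2 * t p ^+ 2 = (eps * t p) ^+ 2.
    by rewrite ee expr1n mul1r exprMn [eps ^+ 2]expr2 ee mul1r.
  by rewrite sqrtr_sqr gtr0_norm// mulrA ee mul1r.
split=> //; apply: (graph_local_param lpi cpi oU smX _ _ XU) => [x Ux|]; first exact: pi_i.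
have -> : [set p | 0 < eps * t p] = (fun p => eps * t p) @^-1` [set y | 0 < y] by [].
apply: open_comp; last exact: open_gt.
by move=> p _; apply: cvgM; [exact: cvg_cst|exact: ct].
Qed.

End Charts.

(** * The upper sheet of the hyperboloid *)

Section Coordinates.
Context {R : realType} {k : nat}.

Definition extend (a : 'rV[R]_k) (c : R) : 'rV[R]_k.+1 :=
  \row_i (if unlift ord_max i is Some j then a 0 j else c).

Definition space_part (y : 'rV[R]_k.+1) : 'rV[R]_k := \row_j y 0 (lift ord_max j).

Definition sqr_norm (a : 'rV[R]_k) : R := \sum_j a 0 j ^+ 2.

Lemma extend_last a c : extend a c 0 ord_max = c.
Proof. by rewrite mxE unlift_none. Qed.

Lemma space_part_extend a c : space_part (extend a c) = a.
Proof. by apply/rowP => j; rewrite !mxE liftK. Qed.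

Lemma extend_space_part y : extend (space_part y) (y 0 ord_max) = y.
Proof.
by apply/rowP => i; rewrite mxE; case: unliftP => [j|] ->; rewrite ?mxE.
Qed.

Lemma extendD a b c d s : extend (s *: a + b) (s * c + d) = s *: extend a c + extend b d.
Proof. by apply/rowP => i; rewrite !mxE; case: unlift => [j|]; rewrite ?mxE. Qed.

Lemma extend_delta a c : extend a c = extend a 0 + c *: delta_mx 0 ord_max.
Proof.
apply/rowP => i; rewrite !mxE; case: unliftP => [j|] ->.
  by rewrite eq_sym (negbTE (neq_lift _ _)) andbF mulr0 addr0.
by rewrite !eqxx mulr1 add0r.
Qed.

Lemma space_partD s y z : space_part (s *: y + z) = s *: space_part y + space_part z.
Proof. by apply/rowP => i; rewrite !mxE. Qed.

Lemma sqr_norm_ge0 a : 0 <= sqr_norm a.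
Proof. by apply: sumr_ge0 => i _; exact: sqr_ge0. Qed.

Lemma lorentz_space_part y : lorentz y y = sqr_norm (space_part y) - y 0 ord_max ^+ 2.
Proof.
rewrite lorentz_sqr; congr (_ - _); apply: eq_bigr => j _; rewrite mxE.
by congr (y 0 _ ^+ 2); apply: val_inj; rewrite /= /bump leqNgt ltn_ord.
Qed.

Definition sheet (r : R) (a : 'rV[R]_k) : 'rV[R]_k.+1 :=
  extend a (Num.sqrt (r ^+ 2 + sqr_norm a)).

Lemma smooth_upto_sqr_norm (V : normedModType R) n (f : V -> 'rV[R]_k) :
  linear f -> continuous f -> smooth_upto n setT (fun x => sqr_norm (f x)).
Proof.
move=> lf cf; apply: (smooth_upto_sum openT) => i.
have se : smooth_upto n setT (fun x => f x 0 i).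
  apply: (@smooth_upto_comp_linear R V 'rV[R]_k R^o n setT (fun y => y 0 i) f openT).
  - by move=> a x y; rewrite !mxE.
  - exact: coord_continuous.
  - exact: (smooth_upto_comp_linear openT lf cf (smooth_upto_id openT n)).
exact: (smooth_uptoM openT se se).
Qed.

Lemma sheet_radicand_gt0 r a : 0 < r -> 0 < r ^+ 2 + sqr_norm a.
Proof. by move=> r0; apply: ltr_pwDl; [exact: exprn_gt0|exact: sqr_norm_ge0]. Qed.

Lemma sheet_hyperboloid r a : 0 < r ->
  lorentz (sheet r a) (sheet r a) = - r ^+ 2 /\ 0 < sheet r a 0 ord_max.
Proof.
move=> r0; have p := sheet_radicand_gt0 a r0.
rewrite lorentz_space_part /sheet space_part_extend extend_last sqrtr_gt0 p; split=> //.
by rewrite sqr_sqrtr ?ltW// opprD addrCA subrr addr0.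
Qed.

Lemma hyperboloid_sheet r y : 0 < r ->
  lorentz y y = - r ^+ 2 -> 0 < y 0 ord_max -> y = sheet r (space_part y).
Proof.
rewrite lorentz_space_part => r0 yy y0; rewrite -[LHS]extend_space_part; congr (extend _ _).
have -> : r ^+ 2 + sqr_norm (space_part y) = y 0 ord_max ^+ 2.
  by apply/eqP; rewrite addrC -subr_eq0 addrAC yy addNr.
by rewrite sqrtr_sqr gtr0_norm.
Qed.

(** The last coordinate vanishes nowhere on the hyperboloid, hence keeps its sign on a
    connected subset; conversely a segment of graph coordinates joins any point of the upper
    sheet to the base point. *)
Lemma hyperbolicE r : 0 < r ->
  hyperbolic k r = [set y : 'rV[R]_k.+1 | lorentz y y = - r ^+ 2 /\ 0 < y 0 ord_max].
Proof.
move=> r0; pose base : 'rV[R]_k.+1 := r *: delta_mx 0 ord_max.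
apply/seteqP; split=> [y [C [Cb CA cC] Cy]|y [yy y0]].
  split; first exact: CA.
  have iC : is_interval ((fun z : 'rV[R]_k.+1 => z 0 ord_max) @` C).
    apply/connected_intervalP; apply: connected_continuous_connected => //.
    apply: continuous_subspaceT; exact: coord_continuous.
  rewrite ltNge; apply/negP => y0.
  have Iy : ((fun z : 'rV[R]_k.+1 => z 0 ord_max) @` C) (y 0 ord_max) by exists y.
  have Ib : ((fun z : 'rV[R]_k.+1 => z 0 ord_max) @` C) r.
    by exists base; [exact: Cb|rewrite !mxE !eqxx mulr1].
  have [|z Cz z0] := iC _ _ Iy Ib 0; first by rewrite y0 ltW.
  have := CA z Cz; rewrite /= lorentz_space_part z0 expr0n /= subr0 => e.
  have := sqr_norm_ge0 (space_part z); rewrite e oppr_ge0 leNgt exprn_gt0//.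
pose path (t : R) := sheet r (t *: space_part y).
exists (path @` `[0, 1]); last first.
  exists 1; first by rewrite /= in_itv /= ler01 lexx.
  by rewrite /path scale1r -hyperboloid_sheet.
split.
- exists 0; first by rewrite /= in_itv /= ler01 lexx.
  rewrite /path scale0r /sheet /sqr_norm big1 => [|i _]; last by rewrite mxE expr0n.
  rewrite addr0 sqrtr_sqr gtr0_norm// extend_delta.
  by rewrite [X in X + _](_ : _ = 0) ?add0r//; apply/rowP => i; rewrite !mxE; case: unlift => [j|]; rewrite ?mxE.
- by move=> _ [t _ <-]; have [] := sheet_hyperboloid (t *: space_part y) r0.
- apply: connected_continuous_connected; first exact: segment_connected.
  apply: continuous_subspaceT => t.
  have ls : linear (fun t : R^o => t *: space_part y).
    by move=> a u v; rewrite scalerDl scalerA.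
  have cs : continuous (fun t : R^o => t *: space_part y).
    by move=> u; apply: cvgZr_tmp; exact: cvg_id.
  have se : smooth_upto 0 setT (fun t : R^o => r ^+ 2 + sqr_norm (t *: space_part y)).
    exact: (smooth_uptoD openT (smooth_upto_cst openT 0 (r ^+ 2 : R)) (smooth_upto_sqr_norm 0 ls cs)).
  have [dq _] := smooth_upto_sqrt openT (fun t _ => sheet_radicand_gt0 _ r0) se.
  have -> : path = fun t => extend (t *: space_part y) 0 +
      Num.sqrt (r ^+ 2 + sqr_norm (t *: space_part y)) *: delta_mx 0 ord_max.
    by apply/funext => u; rewrite -extend_delta.
  apply: cvgD.
    apply: (@continuous_comp R^o _ _ (fun t : R^o => t *: space_part y) (extend ^~ 0)); first exact: cs.
    apply: linear_continuous_rV => a u v; by rewrite -extendD mulr0 addr0.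
  apply: cvgZr_tmp; exact: (differentiable_continuous (dq t I)).
Qed.

End Coordinates.

(** * Charts of the product and of the anti de Sitter space *)

Section Parametrizations.
Context {R : realType} (m n : nat).
Local Notation E := ('rV[R]_m.+1 * 'rV[R]_n.+1)%type.

Definition product_chart (r : R) (x : 'rV[R]_(m + n)) : E :=
  (sheet r (lsubmx x), sheet r (rsubmx x)).

Definition product_coordinates (p : E) : 'rV[R]_(m + n) :=
  row_mx (space_part p.1) (space_part p.2).

Lemma product_chart_local_param (r : R) : 0 < r ->
  local_param (M := hyperbolic_prod m n r r) setT (product_chart r) /\
  (product_chart r) @` setT = carrier (hyperbolic_prod m n r r).
Proof.
move=> r0.
have lpi : linear product_coordinates.
  move=> a p q; rewrite /product_coordinates /= !space_partD.
  by rewrite scale_row_mx add_row_mx.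
have XU : (product_chart r) @` setT = carrier (hyperbolic_prod m n r r).
  apply/seteqP; split=> [_ [x _ <-]|p]; rewrite /= !hyperbolicE//.
    by split; exact: sheet_hyperboloid.
  move=> [[p1 p1'] [p2 p2']]; exists (product_coordinates p) => //.
  rewrite /product_chart /product_coordinates row_mxKl row_mxKr.
  by rewrite -!hyperboloid_sheet// -surjective_pairing.
split=> //.
apply: (@graph_local_param R (hyperbolic_prod m n r r) setT (product_chart r) product_coordinates setT).
- exact: lpi.
- exact: linear_continuous_rV2 lpi.
- exact: openT.
- have ll : linear (@lsubmx R 1 m n) by move=> a x y; exact: linearP.
  have lr : linear (@rsubmx R 1 m n) by move=> a x y; exact: linearP.
  have cl := linear_continuous_rV ll; have cr := linear_continuous_rV lr.
  have -> : product_chart r = fun x => (extend (lsubmx x) 0, extend (rsubmx x) 0) +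
      (Num.sqrt (r ^+ 2 + sqr_norm (lsubmx x)) *: (delta_mx 0 ord_max, 0) +
       Num.sqrt (r ^+ 2 + sqr_norm (rsubmx x)) *: (0, delta_mx 0 ord_max) : E).
    apply/funext => x; rewrite /product_chart /sheet !(extend_delta _ (Num.sqrt _)).
    by congr (_, _); rewrite /= ?scaler0 ?addr0 ?add0r.
  apply/smooth_onP => d; apply: (smooth_uptoD openT).
    apply: (@smooth_upto_comp_linear R _ _ E d setT
      (fun x => (extend (lsubmx x) 0, extend (rsubmx x) 0)) id openT _ _ (smooth_upto_id openT d)).
      move=> a x y; congr (_, _); rewrite /= linearP -extendD mulr0 addr0 //.
    apply: linear_continuous_rV => a x y.
    by congr (_, _); rewrite /= linearP -extendD mulr0 addr0.
  have sroot k (f : 'rV[R]_(m + n) -> 'rV[R]_k) (e : E) : linear f -> continuous f ->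
      smooth_upto d setT (fun x => Num.sqrt (r ^+ 2 + sqr_norm (f x)) *: e).
    move=> lf cf; apply: (smooth_upto_scale _ openT).
    apply: (smooth_upto_sqrt openT) => [x _|]; first exact: sheet_radicand_gt0.
    exact: (smooth_uptoD openT (smooth_upto_cst openT d (r ^+ 2 : R)) (smooth_upto_sqr_norm d lf cf)).
  by apply: (smooth_uptoD openT); exact: sroot.
- by move=> x _; rewrite /product_coordinates /product_chart !space_part_extend hsubmxK.
- exact: openT.
- by rewrite XU setIT.
Qed.

(** 1 + ads_radicand is the square of one timelike coordinate of a point of the anti de Sitter
    space as a function of the others, the other timelike coordinate being stored last. *)
Definition ads_radicand (x : 'rV[R]_(m + n + 1)) : R :=
  sqr_norm (lsubmx (lsubmx x)) + sqr_norm (rsubmx (lsubmx x)) - rsubmx x 0 0 ^+ 2.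

Lemma smooth_ads_radicand d : smooth_upto d setT ads_radicand.
Proof.
have lll : linear (fun x : 'rV[R]_(m + n + 1) => lsubmx (lsubmx x)).
  by move=> a x y; rewrite !linearP.
have llr : linear (fun x : 'rV[R]_(m + n + 1) => rsubmx (lsubmx x)).
  by move=> a x y; rewrite !linearP.
have lr : linear (fun x : 'rV[R]_(m + n + 1) => rsubmx x 0 0 : R^o).
  by move=> a x y; rewrite !mxE.
have sr : smooth_upto d setT (fun x : 'rV[R]_(m + n + 1) => rsubmx x 0 0 : R).
  exact: (smooth_upto_comp_linear openT lr (linear_continuous_rV lr) (smooth_upto_id openT d)).
have s1 := smooth_upto_sqr_norm d lll (linear_continuous_rV lll).
have s2 := smooth_upto_sqr_norm d llr (linear_continuous_rV llr).
have s3 := smooth_uptoM openT (smooth_upto_cst openT d (-1 : R)) (smooth_uptoM openT sr sr).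
apply: (smooth_upto_eq openT _ (smooth_uptoD openT (smooth_uptoD openT s1 s2) s3)) => x _.
by rewrite /ads_radicand /= mulN1r expr2.
Qed.

Definition ads_coordinates1 (p : E) : 'rV[R]_(m + n + 1) :=
  row_mx (row_mx (space_part p.1) (space_part p.2)) (p.2 0 ord_max)%:M.
Definition ads_coordinates2 (p : E) : 'rV[R]_(m + n + 1) :=
  row_mx (row_mx (space_part p.1) (space_part p.2)) (p.1 0 ord_max)%:M.
Definition ads_graph1 (x : 'rV[R]_(m + n + 1)) : E :=
  (extend (lsubmx (lsubmx x)) 0, extend (rsubmx (lsubmx x)) (rsubmx x 0 0)).
Definition ads_graph2 (x : 'rV[R]_(m + n + 1)) : E :=
  (extend (lsubmx (lsubmx x)) (rsubmx x 0 0), extend (rsubmx (lsubmx x)) 0).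

Definition ads_chart1 (eps : R) (x : 'rV[R]_(m + n + 1)) : E :=
  ads_graph1 x + (eps * Num.sqrt (1 + ads_radicand x)) *: (delta_mx 0 ord_max, 0).
Definition ads_chart2 (eps : R) (x : 'rV[R]_(m + n + 1)) : E :=
  ads_graph2 x + (eps * Num.sqrt (1 + ads_radicand x)) *: (0, delta_mx 0 ord_max).

Lemma ads_coordinates1_linear : linear ads_coordinates1.
Proof.
move=> a p q; rewrite /ads_coordinates1 /= !space_partD !scale_row_mx !add_row_mx.
by congr row_mx; rewrite scale_scalar_mx -raddfD !mxE.
Qed.

Lemma ads_coordinates2_linear : linear ads_coordinates2.
Proof.
move=> a p q; rewrite /ads_coordinates2 /= !space_partD !scale_row_mx !add_row_mx.
by congr row_mx; rewrite scale_scalar_mx -raddfD !mxE.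
Qed.

Lemma ads_chart1_local_param (eps : R) : eps * eps = 1 ->
  local_param (M := anti_de_sitter R m n) [set x | 0 < 1 + ads_radicand x] (ads_chart1 eps) /\
  ads_chart1 eps @` [set x | 0 < 1 + ads_radicand x] =
    carrier (anti_de_sitter R m n) `&` [set p : E | 0 < eps * p.1 0 ord_max].
Proof.
move=> ee.
apply: (@square_root_chart R (anti_de_sitter R m n) ads_radicand ads_coordinates1 ads_graph1
  (fun p : E => p.1 0 ord_max) (delta_mx 0 ord_max, 0) eps) => //.
- exact: smooth_ads_radicand.
- exact: ads_coordinates1_linear.
- exact: linear_continuous_rV2 ads_coordinates1_linear.
- by move=> a x y; congr (_, _); rewrite /= -extendD ?mulr0 ?addr0 !linearP// !mxE.
- have lt : linear (fun p : E => p.1 0 ord_max : R^o) by move=> a p q; rewrite /= !mxE.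
  exact: (linear_continuous_rV2 lt).
- move=> x s; rewrite /ads_coordinates1 /= scaler0 addr0 -extend_delta !space_part_extend extend_last.
  by rewrite -mx11_scalar !hsubmxK.
- by move=> x s; rewrite /= -extend_delta extend_last.
- move=> p; rewrite /ads_coordinates1 /ads_graph1 !(row_mxKl, row_mxKr) mxE eqxx mulr1n.
  rewrite [LHS]surjective_pairing; congr (_, _); rewrite /= -?extend_delta ?scaler0 ?addr0.
    by rewrite extend_space_part.
  by rewrite extend_space_part.
- move=> p; rewrite /ads_coordinates1 /ads_radicand !(row_mxKl, row_mxKr) mxE eqxx mulr1n /=.
  rewrite /sum_scalar !lorentz_space_part.
  by split=> e; lra.
Qed.

Lemma ads_chart2_local_param (eps : R) : eps * eps = 1 ->
  local_param (M := anti_de_sitter R m n) [set x | 0 < 1 + ads_radicand x] (ads_chart2 eps) /\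
  ads_chart2 eps @` [set x | 0 < 1 + ads_radicand x] =
    carrier (anti_de_sitter R m n) `&` [set p : E | 0 < eps * p.2 0 ord_max].
Proof.
move=> ee.
apply: (@square_root_chart R (anti_de_sitter R m n) ads_radicand ads_coordinates2 ads_graph2
  (fun p : E => p.2 0 ord_max) (0, delta_mx 0 ord_max) eps) => //.
- exact: smooth_ads_radicand.
- exact: ads_coordinates2_linear.
- exact: linear_continuous_rV2 ads_coordinates2_linear.
- by move=> a x y; congr (_, _); rewrite /= -extendD ?mulr0 ?addr0 !linearP// !mxE.
- have lt : linear (fun p : E => p.2 0 ord_max : R^o) by move=> a p q; rewrite /= !mxE.
  exact: (linear_continuous_rV2 lt).
- move=> x s; rewrite /ads_coordinates2 /= scaler0 addr0 -extend_delta !space_part_extend extend_last.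
  by rewrite -mx11_scalar !hsubmxK.
- by move=> x s; rewrite /= -extend_delta extend_last.
- move=> p; rewrite /ads_coordinates2 /ads_graph2 !(row_mxKl, row_mxKr) mxE eqxx mulr1n.
  rewrite [LHS]surjective_pairing; congr (_, _); rewrite /= -?extend_delta ?scaler0 ?addr0.
    by rewrite extend_space_part.
  by rewrite extend_space_part.
- move=> p; rewrite /ads_coordinates2 /ads_radicand !(row_mxKl, row_mxKr) mxE eqxx mulr1n /=.
  rewrite /sum_scalar !lorentz_space_part.
  by split=> e; lra.
Qed.

Lemma hyperbolic_prod_submanifold (r : R) : 0 < r -> submanifold (hyperbolic_prod m n r r).
Proof.
move=> r0 p Mp; have [lX XU] := product_chart_local_param r0.
by exists setT, (product_chart r); split=> //; rewrite XU.
Qed.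

Lemma ads_submanifold : submanifold (anti_de_sitter R m n).
Proof.
move=> p Np.
have sgn (a : R) : a != 0 -> exists2 eps : R, eps * eps = 1 & 0 < eps * a.
  move=> a0; case: (ltrgt0P a) a0 => // a0 _.
    by exists 1; rewrite ?mulr1 ?mul1r.
  by exists (-1); rewrite ?mulrNN ?mulr1 ?mulN1r ?oppr_gt0.
have [p10|p10] := eqVneq (p.1 0 ord_max) 0; last first.
  have [eps ee ep] := sgn _ p10; have [lX XU] := ads_chart1_local_param ee.
  by exists [set x | 0 < 1 + ads_radicand x], (ads_chart1 eps); split=> //; rewrite XU.
have p20 : p.2 0 ord_max != 0.
  apply/eqP => p20; move: Np; rewrite /= /sum_scalar !lorentz_space_part p10 p20 expr0n /= !subr0 => e.
  have : 0 <= sqr_norm (space_part p.1) + sqr_norm (space_part p.2).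
    by rewrite addr_ge0// sqr_norm_ge0.
  by rewrite e oppr_ge0 ler10.
have [eps ee ep] := sgn _ p20; have [lX XU] := ads_chart2_local_param ee.
by exists [set x | 0 < 1 + ads_radicand x], (ads_chart2 eps); split=> //; rewrite XU.
Qed.

(** The first timelike coordinate is positive on the product, so that a single graph chart of
    the anti de Sitter space suffices. *)
Lemma inclusion_local_expr (r : R) : 0 < r -> r ^+ 2 = 2^-1 ->
  local_expr (M := hyperbolic_prod m n r r) (N := anti_de_sitter R m n) (inclusion_map m n r r)
    setT (product_chart r) [set x | 0 < 1 + ads_radicand x] (ads_chart1 1)
    (fun x => ads_coordinates1 (product_chart r x)).
Proof.
move=> r0 r2; have [lX XU] := product_chart_local_param r0.
have [lY YW] := ads_chart1_local_param (mulr1 (1 : R)).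
have [oT smX _ _ _] := lX.
have lc := ads_coordinates1_linear.
split=> //.
  apply/smooth_onP => d; apply: (smooth_upto_comp_linear openT lc (linear_continuous_rV2 lc)).
  by move/smooth_onP : smX; apply.
move=> x _; have [h1 h1'] := sheet_hyperboloid (lsubmx x) r0.
have [h2 h2'] := sheet_hyperboloid (rsubmx x) r0.
have : (carrier (anti_de_sitter R m n) `&` [set p : E | 0 < 1 * p.1 0 ord_max]) (product_chart r x).
  split=> /=; last by rewrite mul1r.
  by rewrite /sum_scalar h1 h2 r2 -opprD -[X in X + X]mul1r -splitr.
rewrite -YW => -[y Wy yE].
have -> : ads_coordinates1 (product_chart r x) = y.
  rewrite -yE /ads_coordinates1 /ads_chart1 /ads_graph1 /= scaler0 addr0 -extend_delta.
  by rewrite !space_part_extend extend_last -mx11_scalar !hsubmxK.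
by split=> //; rewrite yE /inclusion_map -surjective_pairing.
Qed.

End Parametrizations.

(** * The Laplacian of the product of hyperboloids *)

Section HyperbolicParametrization.
Context {R : realType} {m n : nat}.
Local Notation E := ('rV[R]_m.+1 * 'rV[R]_n.+1)%type.
Local Notation sp := (@sum_scalar R m n).
Let spP : scalar_product sp := sum_scalar_product R m n.
Variables (U : set 'rV[R]_(m + n)) (X : 'rV[R]_(m + n) -> E).
Hypotheses (oU : open U) (smX : smooth_on U X).
Hypothesis freeX : forall x, U x -> forall c, combination (fun a => partial a X x) c = 0 -> c = 0.
Hypothesis X1 : forall x, U x -> lorentz (X x).1 (X x).1 = - 2^-1.
Hypothesis X2 : forall x, U x -> lorentz (X x).2 (X x).2 = - 2^-1.

Let g := gram sp X.

(* The scalar products of the two factors, degenerate on the sum. *)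
Let sp1 (p q : E) := lorentz p.1 q.1.
Let sp2 (p q : E) := lorentz p.2 q.2.

Let sp1P : scalar_product sp1.
Proof.
split=> [x y|z a x y|p]; first exact: lorentz_sym.
  exact: (lorentz_linear z.1 a x.1 y.1).
apply: (@continuous_lorentz _ _ _ (fun q => q.1.1) (fun q => q.2.1)) => x.
  by apply: continuous_comp; exact: cvg_fst.
by apply: continuous_comp; [exact: cvg_snd|exact: cvg_fst].
Qed.

Let sp2P : scalar_product sp2.
Proof.
split=> [x y|z a x y|p]; first exact: lorentz_sym.
  exact: (lorentz_linear z.2 a x.2 y.2).
apply: (@continuous_lorentz _ _ _ (fun q => q.1.2) (fun q => q.2.2)) => x.
  by apply: continuous_comp; [exact: cvg_fst|exact: cvg_snd].
by apply: continuous_comp; exact: cvg_snd.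
Qed.

Lemma hyperbolic_normal1 a x : U x -> lorentz (partial a X x).1 (X x).1 = 0.
Proof. by move=> Ux; exact: (partial_normal sp1P oU smX X1 a Ux). Qed.

Lemma hyperbolic_normal2 a x : U x -> lorentz (partial a X x).2 (X x).2 = 0.
Proof. by move=> Ux; exact: (partial_normal sp2P oU smX X2 a Ux). Qed.

Lemma hyperbolic_param_gram_unit x : U x -> g x \in unitmx.
Proof.
move=> Ux; exact: (hyperbolic_gram_unit (freeX Ux) (X1 Ux) (X2 Ux)
  (fun a => hyperbolic_normal1 a Ux) (fun a => hyperbolic_normal2 a Ux)).
Qed.

Lemma hyperbolic_param_posdef x : U x -> posdef (g x).
Proof.
move=> Ux; exact: (hyperbolic_gram_posdef (freeX Ux) (X1 Ux) (X2 Ux)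
  (fun a => hyperbolic_normal1 a Ux) (fun a => hyperbolic_normal2 a Ux)).
Qed.

Let normal1 (p : E) : E := (p.1, 0).
Let normal2 (p : E) : E := (0, p.2).

(** Gauss formula of the product: the Hessian is orthogonal to the coordinate fields, and its
    products with the normals (u, 0) and (0, v), of square -1/2, are - <u_i, u_j> and
    - <v_i, v_j>. *)
Lemma hyperbolic_hessian i j x : U x ->
  hessian g X i j x =
    (2 * sp1 (partial i X x) (partial j X x)) *: normal1 (X x) +
    (2 * sp2 (partial i X x) (partial j X x)) *: normal2 (X x).
Proof.
move=> Ux; apply: subr0_eq.
set H := hessian _ _ _ _ _; set a := sp1 _ _; set b := sp2 _ _.
have T1 c := hyperbolic_normal1 c Ux; have T2 c := hyperbolic_normal2 c Ux.
apply: (hyperbolic_frame_nondegenerate (freeX Ux) (X1 Ux) (X2 Ux) T1 T2) => [l||].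
- have orth : sp ((2 * a) *: normal1 (X x) + (2 * b) *: normal2 (X x)) (partial l X x) = 0.
    rewrite (scalarDl spP) !(scalarZl spP) /sum_scalar /= !lorentz0l.
    rewrite (lorentz_sym (X x).1) (lorentz_sym (X x).2) T1 T2.
    by rewrite !addr0 !mulr0 addr0.
  apply: (etrans (scalarBl spP _ _ _)); rewrite orth subr0.
  rewrite (scalarBl spP) (scalar_suml spP) -(christoffel_gram spP oU smX i j l Ux (hyperbolic_param_gram_unit Ux)).
  apply/eqP; rewrite subr_eq0; apply/eqP.
  by apply: eq_bigr => k _; rewrite (scalarZl spP) gramE.
- have v1 : sp1 ((2 * a) *: normal1 (X x) + (2 * b) *: normal2 (X x)) (X x) = - a.
    rewrite (scalarDl sp1P) !(scalarZl sp1P) /sp1 /= lorentz0l X1//.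
    by rewrite mulr0 addr0 mulrN mulrAC mulfV// mul1r.
  apply: (etrans (scalarBl sp1P _ _ _)); rewrite v1; apply/eqP; rewrite subr_eq0; apply/eqP.
  rewrite (scalarBl sp1P) (scalar_suml sp1P) big1 => [|k _]; last first.
    by rewrite (scalarZl sp1P) {1}/sp1 T1 mulr0.
  rewrite subr0; apply: (etrans (partial2_normal sp1P oU smX X1 i j Ux)).
  by rewrite gramE.
- have v2 : sp2 ((2 * a) *: normal1 (X x) + (2 * b) *: normal2 (X x)) (X x) = - b.
    rewrite (scalarDl sp2P) !(scalarZl sp2P) /sp2 /= lorentz0l X2//.
    by rewrite mulr0 add0r mulrN mulrAC mulfV// mul1r.
  apply: (etrans (scalarBl sp2P _ _ _)); rewrite v2; apply/eqP; rewrite subr_eq0; apply/eqP.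
  rewrite (scalarBl sp2P) (scalar_suml sp2P) big1 => [|k _]; last first.
    by rewrite (scalarZl sp2P) {1}/sp2 T2 mulr0.
  rewrite subr0; apply: (etrans (partial2_normal sp2P oU smX X2 i j Ux)).
  by rewrite gramE.
Qed.

Lemma trace_factor1 x : U x ->
  \sum_i \sum_j invmx (g x) i j * sp1 (partial i X x) (partial j X x) = m%:R.
Proof.
move=> Ux; exact: (hyperbolic_trace1 (freeX Ux) (X1 Ux) (X2 Ux)
  (fun a => hyperbolic_normal1 a Ux) (fun a => hyperbolic_normal2 a Ux)).
Qed.

Lemma trace_factor2 x : U x ->
  \sum_i \sum_j invmx (g x) i j * sp2 (partial i X x) (partial j X x) = n%:R.
Proof.
move=> Ux; exact: (hyperbolic_trace2 (freeX Ux) (X1 Ux) (X2 Ux)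
  (fun a => hyperbolic_normal1 a Ux) (fun a => hyperbolic_normal2 a Ux)).
Qed.

Lemma hyperbolic_laplacian x : U x ->
  \sum_i \sum_j invmx (g x) i j *: hessian g X i j x =
    (2 * m%:R *: (X x).1, 2 * n%:R *: (X x).2).
Proof.
move=> Ux; have -> : (2 * m%:R *: (X x).1, 2 * n%:R *: (X x).2) =
    (2 * m%:R) *: normal1 (X x) + (2 * n%:R) *: normal2 (X x).
  by congr (_, _); rewrite /= scaler0 ?addr0 ?add0r.
rewrite -(trace_factor1 Ux) -(trace_factor2 Ux) !mulr_sumr !scaler_suml -big_split.
apply: eq_bigr => i _; rewrite !mulr_sumr !scaler_suml -big_split.
apply: eq_bigr => j _; apply: (etrans (congr1 (fun u => _ *: u) (hyperbolic_hessian i j Ux))).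
by rewrite scalerDr !scalerA !(mulrCA 2).
Qed.

End HyperbolicParametrization.

(** * The inclusion *)

Section ChartsOfQuadrics.
Context {R : realType} {m n : nat}.
Local Notation E := ('rV[R]_m.+1 * 'rV[R]_n.+1)%type.
Local Notation sp := (@sum_scalar R m n).
Let spP : scalar_product sp := sum_scalar_product R m n.

Lemma local_param_carrier (S : subspace_data R) U X : local_param (M := S) U X ->
  forall x, U x -> carrier S (X x).
Proof.
move=> [oU _ _ _ hX] x Ux; have [B _ XU] := hX U oU (fun _ => id).
by have [] : (carrier S `&` B) (X x) by rewrite -XU; exists x.
Qed.

Lemma local_param_free d (U : set 'rV[R]_d) (X : 'rV[R]_d -> E) x :
  smooth_on U X -> (forall y, U y -> injective ('d X y)) -> U x ->
  forall c, combination (fun a => partial a X x) c = 0 -> c = 0.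
Proof.
move=> smX injX Ux c c0; apply: (injX x Ux); rewrite linear0 -c0.
exact: diff_rV (smooth_on_differentiable smX Ux).
Qed.

Section AdsChart.
Variables (W : set 'rV[R]_(m + n + 1)) (Y : 'rV[R]_(m + n + 1) -> E).
Hypothesis lY : local_param (M := anti_de_sitter R m n) W Y.

Lemma ads_chart_unit y : W y -> sp (Y y) (Y y) = -1.
Proof. exact: local_param_carrier lY y. Qed.

Let oW : open W. Proof. by have [] := lY. Qed.
Let smY : smooth_on W Y. Proof. by have [] := lY. Qed.
Let freeY y : W y -> forall c, combination (fun a => partial a Y y) c = 0 -> c = 0.
Proof. by have [_ _ injY _ _] := lY; exact: local_param_free. Qed.
Let normalY y a : W y -> sp (partial a Y y) (Y y) = 0.
Proof. by move=> Wy; exact: (partial_normal spP oW smY ads_chart_unit a Wy). Qed.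

Lemma ads_chart_gram_unit y : W y -> gram sp Y y \in unitmx.
Proof.
by move=> Wy; exact: (ads_gram_unit (freeY Wy) (ads_chart_unit Wy) (fun a => normalY a Wy)).
Qed.

Lemma ads_chart_index y : W y -> has_index (gram sp Y y) 1.
Proof.
by move=> Wy; exact: (ads_gram_index (freeY Wy) (ads_chart_unit Wy) (fun a => normalY a Wy)).
Qed.

(** The coordinate fields and the position vector span the ambient space. *)
Lemma ads_chart_spans y v : W y ->
  (forall a, sp v (partial a Y y) = 0) -> sp v (Y y) = 0 -> v = 0.
Proof.
by move=> Wy; exact: (ads_frame_nondegenerate (freeY Wy) (ads_chart_unit Wy) (fun a => normalY a Wy)).
Qed.

End AdsChart.

Lemma ads_pseudo_riemannian : pseudo_riemannian (anti_de_sitter R m n) 1.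
Proof.
split; first exact: ads_submanifold.
by move=> W Y lY y Wy; split; [exact: (ads_chart_gram_unit lY Wy)|exact: (ads_chart_index lY Wy)].
Qed.

Section Inclusion.
Variable r : R.
Hypotheses (r0 : 0 < r) (r2 : r ^+ 2 = 2^-1).
Variables (U : set 'rV[R]_(m + n)) (X : 'rV[R]_(m + n) -> E).
Variables (W : set 'rV[R]_(m + n + 1)) (Y : 'rV[R]_(m + n + 1) -> E).
Variable F : 'rV[R]_(m + n) -> 'rV[R]_(m + n + 1).
Hypothesis expr : local_expr (M := hyperbolic_prod m n r r) (N := anti_de_sitter R m n)
  (inclusion_map m n r r) U X W Y F.

Let lX : local_param (M := hyperbolic_prod m n r r) U X. Proof. by have [] := expr. Qed.
Let lY : local_param (M := anti_de_sitter R m n) W Y. Proof. by have [] := expr. Qed.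
Let smF : smooth_on U F. Proof. by have [] := expr. Qed.
Let FW x : U x -> W (F x). Proof. by have [_ _ _ h] := expr; move=> /h[]. Qed.
Let YF x : U x -> Y (F x) = X x.
Proof. by have [_ _ _ h] := expr; move=> /h[_ ->]; rewrite /inclusion_map -surjective_pairing. Qed.
Let oU : open U. Proof. by have [] := lX. Qed.
Let smX : smooth_on U X. Proof. by have [] := lX. Qed.
Let oW : open W. Proof. by have [] := lY. Qed.
Let smY : smooth_on W Y. Proof. by have [] := lY. Qed.
Let freeX x : U x -> forall c, combination (fun a => partial a X x) c = 0 -> c = 0.
Proof. by have [_ _ injX _ _] := lX; exact: local_param_free. Qed.
Let X1 x : U x -> lorentz (X x).1 (X x).1 = - 2^-1.
Proof. by move=> /(local_param_carrier lX)[+ _]; rewrite /= hyperbolicE// -r2 => -[]. Qed.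
Let X2 x : U x -> lorentz (X x).2 (X x).2 = - 2^-1.
Proof. by move=> /(local_param_carrier lX)[_ +]; rewrite /= hyperbolicE// -r2 => -[]. Qed.
Let unitY := ads_chart_unit lY.
Let gramU := ads_chart_gram_unit lY.
Let spanY := ads_chart_spans lY.
Let gramXU := hyperbolic_param_gram_unit oU smX freeX X1 X2.

Let g := gram sp X.
Let h := gram sp Y.

Lemma inclusion_posdef x : U x -> posdef (g x).
Proof. exact: hyperbolic_param_posdef oU smX freeX X1 X2 x. Qed.

(** Both metrics are the scalar products of the ambient vectors that represent the coordinate
    fields of X. *)
Lemma inclusion_pullback x : U x -> pullback_metric h F x = g x.
Proof.
move=> Ux; have dF := smooth_on_differentiable smF Ux.
have dP i := differential_partial smY oU smF FW YF i Ux.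
apply/matrixP => i j; rewrite /pullback_metric /g gramE.
have J k a : 'J F x k a = partial k F x 0 a.
  by rewrite /partial deriveE// /jacobian mxE.
transitivity (sp ('d Y (F x) (partial i F x)) ('d Y (F x) (partial j F x))); last first.
  by congr (sp _ _); exact: dP.
rewrite (scalar_differential2 spP smY _ _ (FW Ux)).
rewrite mxE exchange_big; apply: eq_bigr => b _ /=.
rewrite [X in X * _]mxE [X in _ * X]mxE mulr_suml.
by apply: eq_bigr => a _; rewrite !J mulrAC.
Qed.

Lemma inclusion_rank x : U x -> \rank ('J F x) = (m + n)%N.
Proof.
move=> Ux; apply/eqP; rewrite -/(row_free _); apply: inj_row_free => c c0.
have := inclusion_pullback Ux; rewrite /pullback_metric => e.
have : c *m g x = 0 by rewrite -e !mulmxA c0 !mul0mx.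
move/(congr1 (fun M => M *m invmx (g x))); rewrite mul0mx -mulmxA mulmxV ?mulmx1//.
exact: gramXU.
Qed.

(* m - n times the unit normal (u, -v) of the product at (u, v). *)
Let normal_field (p : E) : E := ((m%:R - n%:R) *: p.1, (n%:R - m%:R) *: p.2).

Let normal_field_linear : linear normal_field.
Proof.
by move=> a p q; congr (_, _); rewrite /= scalerDr !scalerA mulrC.
Qed.

Let normal_fieldE c (p q : E) : c * sp (normal_field p) q =
  (m%:R - n%:R) * (c * lorentz q.1 p.1) + (n%:R - m%:R) * (c * lorentz q.2 p.2).
Proof.
have lZ k (y z : 'rV[R]_k.+1) (s : R) : lorentz (s *: y) z = s * lorentz z y.
  by have := lorentz_linear z s y 0; rewrite !addr0 lorentz0l addr0 (lorentz_sym y).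
by rewrite /sum_scalar /= !lZ mulrDr !(mulrCA c).
Qed.

(** The Laplacian of the position vector (u, v) is (2 m u, 2 n v); removing m + n times the
    position vector leaves (m - n) (u, -v). *)
Lemma inclusion_tension x : U x ->
  'd Y (F x) (tension g h F x) = normal_field (X x).
Proof.
move=> Ux.
apply: (etrans (differential_tension spP oW smY unitY gramU spanY oU smX smF FW YF gramXU Ux)).
apply: (etrans (congr1 (fun u => u - _) (hyperbolic_laplacian oU smX freeX X1 X2 Ux))).
by congr (_, _); rewrite /= -scalerBl natrD; congr (_ *: _); ring.
Qed.

Let normal_smooth : smooth_on U (fun x => normal_field (X x)).
Proof.
apply/smooth_onP => d; apply: (smooth_upto_comp_linear oU normal_field_linear).
  exact: linear_continuous_rV2 normal_field_linear.
by move/smooth_onP : smX; apply.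
Qed.

Let normal_orthogonal x i : U x -> sp (normal_field (X x)) (partial i X x) = 0.
Proof.
move=> Ux; rewrite (scalar_sym spP) /sum_scalar /normal_field /=.
have e1 := hyperbolic_normal1 oU smX X1 i Ux; have e2 := hyperbolic_normal2 oU smX X2 i Ux.
rewrite !(lorentz_sym (partial i X x).1) !(lorentz_sym (partial i X x).2) in e1 e2 *.
have lZ k (y z : 'rV[R]_k.+1) (c : R) : lorentz y z = 0 -> lorentz (c *: y) z = 0.
  by move=> yz; have := lorentz_linear z c y 0; rewrite !addr0 lorentz0l addr0 yz scaler0.
by rewrite !lZ ?addr0.
Qed.

(** The coefficient of u is (m - n) (2 m - (m - n) - (m + n)) and that of v is
    (m - n) (- 2 n - (m - n) + (m + n)); both vanish. *)
Lemma inclusion_bitension x : U x -> bitension g h F x = 0.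
Proof.
move=> Ux; apply: (differential_inj spP smY (FW Ux) (gramU (FW Ux))).
apply: (etrans (differential_bitension spP oW smY unitY gramU spanY oU smF FW YF gramXU
  normal_smooth inclusion_tension (fun x i => @normal_orthogonal x i) Ux)).
have [L LE] := linear_mapP normal_field_linear.
have cL : continuous L by rewrite LE; exact: linear_continuous_rV2 normal_field_linear.
have hessL i j : hessian g (fun z => normal_field (X z)) i j x = normal_field (hessian g X i j x).
  by rewrite -LE; exact: hessian_linear oU cL smX Ux.
have partL j : partial j (fun z => normal_field (X z)) x = normal_field (partial j X x).
  by rewrite -LE; exact: partial_linear cL smX Ux.
have lap : \sum_i \sum_j invmx (g x) i j *: hessian g (fun z => normal_field (X z)) i j x =
    normal_field (2 * m%:R *: (X x).1, 2 * n%:R *: (X x).2).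
  rewrite -(hyperbolic_laplacian oU smX freeX X1 X2 Ux) -LE linear_sum; apply: eq_bigr => i _.
  rewrite linear_sum; apply: eq_bigr => j _; rewrite linearZ; congr (_ *: _).
  by rewrite LE; exact: hessL.
have tr : \sum_i \sum_j invmx (g x) i j *
    sp (partial j (fun z => normal_field (X z)) x) (partial i X x) = (m%:R - n%:R) ^+ 2.
  transitivity ((m%:R - n%:R) * m%:R + (n%:R - m%:R) * n%:R : R); last by ring.
  rewrite -[in X in _ * X + _](trace_factor1 oU smX freeX X1 X2 Ux).
  rewrite -[in X in _ = _ + _ * X](trace_factor2 oU smX freeX X1 X2 Ux).
  rewrite !mulr_sumr -big_split; apply: eq_bigr => i _.
  rewrite !mulr_sumr -big_split; apply: eq_bigr => j _ /=.
  apply: (etrans (congr1 (fun u => _ * sp u _) (partL j))); exact: normal_fieldE.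
have cancel k (y : 'rV[R]_k.+1) (a b c : R) : a - b - c = 0 -> a *: y - b *: y - c *: y = 0.
  by rewrite -!scalerBl => ->; rewrite scale0r.
rewrite lap tr /normal_field.
by congr (_, _); rewrite /= !scalerA; apply: cancel; rewrite natrD; ring.
Qed.

Lemma inclusion_tension_neq0 x : m <> n -> U x -> tension g h F x <> 0.
Proof.
move=> mn Ux t0; have := inclusion_tension Ux; rewrite t0 linear0 => /esym/(congr1 (fun p : E => p.1)).
rewrite /= => /eqP; rewrite scaler_eq0 subr_eq0 eqr_nat => /orP[/eqP//|/eqP X0].
by have := X1 Ux; rewrite X0 lorentz0l => /esym/eqP; rewrite oppr_eq0 invr_eq0 pnatr_eq0.
Qed.

End Inclusion.
End ChartsOfQuadrics.

Theorem mainTheorem4 (R : realType) (m n : nat)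
    (hm : (1 <= m)%N) (hn : (1 <= n)%N) (hmn : m <> n) :
  let r : R := (Num.sqrt 2)^-1 in
  let M := hyperbolic_prod m n r r in
  let N := anti_de_sitter R m n in
  spacelike_hypersurface M N (inclusion_map m n r r) /\
  proper_biharmonic M N (inclusion_map m n r r).
Proof.
move=> r M N.
have r0 : 0 < r by rewrite invr_gt0 sqrtr_gt0.
have r2 : r ^+ 2 = 2^-1 by rewrite exprVn sqr_sqrtr.
have expr := @inclusion_local_expr R m n r r0 r2.
have smooth : smooth_map (M := M) (N := N) (inclusion_map m n r r).
  move=> p Mp; do 5!eexists; split; first exact: expr.
  by have [_ ->] := product_chart_local_param m n r0.
split; split.
- exact: hyperbolic_prod_submanifold.
- exact: ads_pseudo_riemannian.
- by rewrite /= addn1.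
- split=> // U X W Y F e x Ux; exact: (inclusion_rank r0 r2 e Ux).
- move=> U X W Y F e x Ux.
  by rewrite (inclusion_pullback e Ux : pullback_metric (induced_metric Y) F x = _); exact: (inclusion_posdef r0 r2 e Ux).
- by move=> U X W Y F e x Ux; exact: (inclusion_pullback e Ux).
- by move=> U X W Y F e x Ux; exact: (inclusion_bitension r0 r2 e Ux).
- by move=> harm; exact: (inclusion_tension_neq0 r0 r2 expr hmn I (harm _ _ _ _ _ expr 0 I)).
Qed.
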